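(* Let $k,a,b,\Delta$ be positive integers with $a\leqslant b$ coprime, let $\chi=(k-1)+a/b$, and let $\mu,\rho'\in(0,1]$. There exists $\rho_0>0$ such that for every $\rho\in(0,\rho_0]$ there is $\xi_0>0$ such that for every $\xi\in(0,\xi_0]$ there is $n_0$ such that for all $n\geqslant n_0$ and all $\ell,t\in\mathbb{N}$: if $G$ is a $\mu$-robust $(\chi,\rho;t,\ell)$-tiling framework on $n$ vertices and $H\in\mathcal{B}((1-\rho')n,\xi n,\Delta)\cap\mathcal{J}(\chi)$, then $H\subseteq G$.
   Context: Here $B_\chi$ denotes the complete $k$-partite graph with one part of size $a$ and $k-1$ parts of size $b$. $\mathcal{B}(n,w,\Delta)$ is the family of graphs on at most $n$ vertices with maximum degree at most $\Delta$ all of whose connected components have at most $w$ vertices. $\mathcal{J}(\chi)$ is the family of graphs $H$ with $\chi_{\mathrm{cr}}(H)\leqslant\chi$, where for a graph $F$ with $k'=\chi(F)$, $\alpha(F)$ is the minimum over proper $k'$-colourings of the proportion of vertices in a smallest colour class and $\chi_{\mathrm{cr}}(F)=(k'-1)+\frac{\alpha(F)(k'-1)}{1-\alpha(F)}$. A fractional $F$-tiling of $G$ is $\omega:\mathrm{Hom}(F;G)\to[0,1]$ with $\sum_\theta\omega(\theta)|\theta^{-1}(v)|\leqslant1$ for all $v$; weight $v(F)\sum_\theta\omega(\theta)$; $(1-\rho)$-perfect if weight $\geqslant(1-\rho)v(G)$. $K_k(G)$ is the $k$-graph of $k$-cliques of $G$. Tight components of a $k$-graph $J$: subhypergraphs whose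 edge sets are components of the graph on $E(J)$ with $e\sim f$ iff $|e\cap f|=k-1$. Loose components: unions of tight components forming components of the graph on tight components where two are adjacent iff their vertex sets meet. $J$ is $(t,\ell)$-connected if some vertex-spanning subgraph has at most $t$ tight and at most $\ell$ loose components. $v$ and edge $f\not\ni v$ are linked if some edge $e\ni v$ has $|e\cap f|=k-1$; $J$ is linked if every vertex is linked to an edge. $G$ is a $(\chi,\rho;t,\ell)$-tiling framework if it has a $(1-\rho)$-perfect fractional $B_\chi$-tiling and $K_{\lceil\chi\rceil}(G)$ is $(t,\ell)$-connected and linked. An $(\varepsilon,d)$-approximation of $G$ is a subgraph $G'$ with $\deg_{G'}(v)\geqslant\deg_G(v)-d\,v(G)$ for $v\in V(G')$ and $v(G')\geqslant(1-\varepsilon)v(G)$; $G$ is a $\mu$-robust $(\chi,\rho;t,\ell)$-tiling framework if every $(\mu,\mu)$-approximation of $G$ is a $(\chi,\rho;t,\ell)$-tiling framework. *)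

(* Defs.v *)
From HB Require Import structures.
From mathcomp Require Import all_boot all_order all_algebra.
From mathcomp Require Import reals.

Set Implicit Arguments.
Unset Strict Implicit.
Unset Printing Implicit Defensive.

Import Order.TTheory GRing.Theory Num.Theory.

Local Open Scope ring_scope.

Record sgraph (V : finType) := SGraph {
  adj : rel V;
  adj_sym : symmetric adj;
  adj_irr : irreflexive adj }.

Definition degree (V : finType) (G : sgraph V) (v : V) : nat :=
  #|[set u | adj G v u]|.

(* H has an isomorphic copy in G, not necessarily induced or spanning *)
Definition contained_in (U V : finType) (H : sgraph U) (G : sgraph V) : Prop :=
  exists f : U -> V,
    injective f /\ forall x y, adj H x y -> adj G (f x) (f y).

Definition proper (V : finType) (F : sgraph V) (c : nat)
    (f : {ffun V -> 'I_c}) : bool :=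
  [forall x, forall y, adj F x y ==> (f x != f y)].

Definition colourable (V : finType) (F : sgraph V) (c : nat) : bool :=
  [exists f : {ffun V -> 'I_c}, proper F f].

Lemma colourable_ex (V : finType) (F : sgraph V) : exists c, colourable F c.
Proof.
exists #|V|; apply/existsP; exists [ffun x => enum_rank x].
apply/forallP=> x; apply/forallP=> y; apply/implyP=> xy.
rewrite !ffunE (inj_eq enum_rank_inj); apply: contraTneq xy => ->.
by rewrite adj_irr.
Qed.

Definition chromatic_number (V : finType) (F : sgraph V) : nat :=
  ex_minn (colourable_ex F).

(* The default value 1 of the minima is harmless: proportions are at most 1. *)
Definition alpha (R : realType) (V : finType) (F : sgraph V) : R :=
  \big[Order.min/1]_(f : {ffun V -> 'I_(chromatic_number F)} | proper F f)
    \big[Order.min/1]_(i < chromatic_number F)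
      (#|f @^-1: [set i]|%:R / #|V|%:R).

(* An edgeless nonempty F has chromatic number 1 and alpha F = 1, and the
   formula reads 0 + 0/0; since x / 0 = 0 here, chi_cr F = 0.  For the graph
   without vertices, chi_cr F = -1. *)
Definition chi_cr (R : realType) (V : finType) (F : sgraph V) : R :=
  let k' : R := (chromatic_number F)%:R in
  (k' - 1) + alpha R F * (k' - 1) / (1 - alpha R F).

Definition J_family (R : realType) (chi : R) (V : finType) (H : sgraph V)
    : Prop :=
  chi_cr R H <= chi.

Definition B_family (R : realType) (n w : R) (Delta : nat)
    (V : finType) (H : sgraph V) : Prop :=
  [/\ #|V|%:R <= n,
      (forall v, (degree H v <= Delta)%N)
    & forall v, #|[set u | connect (adj H) v u]|%:R <= w].

Section CompleteMultipartite.
Variables (k : nat) (s : 'I_k -> nat).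

Definition multipartite_vertex : finType := {i : 'I_k & 'I_(s i)}.

Definition multipartite_adj : rel multipartite_vertex :=
  fun x y => tag x != tag y.

Lemma multipartite_sym : symmetric multipartite_adj.
Proof. by move=> x y; rewrite /multipartite_adj eq_sym. Qed.

Lemma multipartite_irr : irreflexive multipartite_adj.
Proof. by move=> x; rewrite /multipartite_adj eqxx. Qed.

Definition complete_multipartite : sgraph multipartite_vertex :=
  SGraph multipartite_sym multipartite_irr.

End CompleteMultipartite.

Definition B_chi_part (k a b : nat) (i : 'I_k) : nat :=
  if i == 0%N :> nat then a else b.

Definition B_chi (k a b : nat) :
    sgraph (multipartite_vertex (B_chi_part (k := k) a b)) :=
  complete_multipartite (B_chi_part (k := k) a b).

Definition chi_of (R : realType) (k a b : nat) : R :=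
  (k%:R - 1) + a%:R / b%:R.

Definition Hom (U V : finType) (F : sgraph U) (G : sgraph V)
    : {set {ffun U -> V}} :=
  [set th : {ffun U -> V} | [forall x, forall y, adj F x y ==> adj G (th x) (th y)]].

(* Only the values of w on Hom F G are relevant. *)
Definition fractional_tiling (R : realType) (U V : finType)
    (F : sgraph U) (G : sgraph V) (w : {ffun U -> V} -> R) : Prop :=
  (forall th, th \in Hom F G -> 0 <= w th <= 1) /\
  (forall v : V, \sum_(th in Hom F G) w th * #|th @^-1: [set v]|%:R <= 1).

Definition tiling_weight (R : realType) (U V : finType)
    (F : sgraph U) (G : sgraph V) (w : {ffun U -> V} -> R) : R :=
  #|U|%:R * \sum_(th in Hom F G) w th.

Definition has_perfect_fractional_tiling (R : realType) (U V : finType)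
    (F : sgraph U) (G : sgraph V) (rho : R) : Prop :=
  exists w : {ffun U -> V} -> R,
    fractional_tiling F G w /\ (1 - rho) * #|V|%:R <= tiling_weight F G w.

Definition clique_hypergraph (V : finType) (k : nat) (G : sgraph V)
    : {set {set V}} :=
  [set S : {set V} | (#|S| == k) &&
     [forall x in S, forall y in S, (x != y) ==> adj G x y]].

(* The partition of A into connected components of the graph on A with
   adjacency r; edges of r leaving A are ignored. *)
Definition components (T : finType) (r : rel T) (A : {set T})
    : {set {set T}} :=
  [set [set y in A | connect [rel u v | [&& u \in A, v \in A & r u v]] x y]
     | x in A].

(* Tight and loose components are given by their edge sets; the vertex set of
   a component C is cover C. *)
Definition tight_components (V : finType) (k : nat) (J : {set {set V}})
    : {set {set {set V}}} :=
  components [rel e f : {set V} | #|e :&: f| == k.-1] J.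

Definition loose_components (V : finType) (k : nat) (J : {set {set V}})
    : {set {set {set V}}} :=
  [set cover L | L in
     components [rel C D : {set {set V}} | ~~ [disjoint cover C & cover D]]
       (tight_components k J)].

(* A subgraph of J is vertex-spanning if its edges cover all vertices. *)
Definition tl_connected (V : finType) (k t l : nat) (J : {set {set V}})
    : Prop :=
  exists J' : {set {set V}},
    [/\ J' \subset J, cover J' = [set: V],
        (#|tight_components k J'| <= t)%N
      & (#|loose_components k J'| <= l)%N].

Definition linked_to (V : finType) (k : nat) (J : {set {set V}})
    (v : V) (f : {set V}) : Prop :=
  [/\ f \in J, v \notin f
    & exists e, [/\ e \in J, v \in e & #|e :&: f| = k.-1]].

Definition linked (V : finType) (k : nat) (J : {set {set V}}) : Prop :=
  forall v, exists f, linked_to k J v f.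

(* chi is given by its representation (k - 1) + a / b, which also determines
   the graph B_chi. *)
Definition tiling_framework (R : realType) (k a b : nat) (rho : R) (t l : nat)
    (V : finType) (G : sgraph V) : Prop :=
  let c := `|Num.ceil (chi_of R k a b)|%N in
  [/\ has_perfect_fractional_tiling (B_chi k a b) G rho,
      tl_connected c t l (clique_hypergraph c G)
    & linked c (clique_hypergraph c G)].

Definition approximation (R : realType) (eps d : R) (V : finType)
    (G : sgraph V) (W : {set V}) (G' : sgraph {x : V | x \in W}) : Prop :=
  [/\ (forall x y, adj G' x y -> adj G (val x) (val y)),
      (forall v, (degree G (val v))%:R - d * #|V|%:R <= (degree G' v)%:R)
    & (1 - eps) * #|V|%:R <= #|W|%:R].

Definition robust_tiling_framework (R : realType) (mu : R)
    (k a b : nat) (rho : R) (t l : nat) (V : finType) (G : sgraph V) : Prop :=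
  forall (W : {set V}) (G' : sgraph {x : V | x \in W}),
    approximation mu mu G G' -> tiling_framework k a b rho t l G'.

(* Main.v *)
Require Import Defs.
From HB Require Import structures.
From mathcomp Require Import all_boot all_order all_fingroup all_algebra.
From mathcomp Require Import reals.
From mathcomp Require Import ring lra.

Set Implicit Arguments.
Unset Strict Implicit.
Unset Printing Implicit Defensive.

Import Order.TTheory GRing.Theory Num.Theory.
Local Open Scope ring_scope.

(** Small components make the tight and loose connectivity of the framework
    superfluous. A Szemeredi partition of [G] with boundedly many parts turns
    [G], after deleting few edges and vertices, into an approximation [G'] in
    which every edge runs inside a lower-regular pair of large clusters. A
    fractional [B_chi]-tiling of [G'] projects to a probability distribution on
    tuples of pairwise regular clusters, weighted [a, b, ..., b]. The bound
    [chi_cr H <= chi] gives a [k]-colouring of [H] with a class of proportion at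
    most [a / (a + (k - 1) b)]; mixing the permutations of its colours
    suitably makes the mean class sizes proportional to [a, b, ..., b].
    Assigning a random tuple and a random permutation to each component
    loads every cluster below capacity, up to a deviation whose square is at
    most [xi n^2] by a second-moment argument. A linear part of every
    cluster thus stays free, and as each component is much smaller than
    that part, the components are embedded greedily one after the other. *)

(** * Energy increment and regularity *)

Definition cond_mean {R : realFieldType} {T K : finType} (p : T -> K)
    (f : T -> R) (t : T) : R :=
  (\sum_(s | p s == p t) f s) / #|[set s | p s == p t]|%:R.

(** [h] is constant on the classes of [p]. After exchanging the double sum over pairs in a common
    class, each [f s * h s / N s] occurs exactly [N s] times. *)
Lemma cond_mean_tower (R : realFieldType) (T K : finType) (p : T -> K)
    (f : T -> R) (h : T -> R) :
  (forall s t, p s = p t -> h s = h t) ->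
  \sum_t cond_mean p f t * h t = \sum_t f t * h t.
Proof.
move=> hp; pose N t : R := #|[set s | p s == p t]|%:R.
have -> : \sum_t cond_mean p f t * h t =
    \sum_t \sum_(s | p s == p t) f s * h t / N t.
  apply: eq_bigr => t _; rewrite /cond_mean -/(N t) mulrAC mulr_suml mulr_suml.
  exact: eq_bigr.
rewrite (exchange_big_dep xpredT) //=; apply: eq_bigr => s _.
have Ns0 : N s != 0.
  rewrite /N pnatr_eq0 -lt0n; apply/card_gt0P; exists s.
  by rewrite inE.
rewrite (eq_bigr (fun=> f s * h s / N s)); last first.
  by move=> t /eqP st; rewrite (hp _ _ st) /N st.
rewrite sumr_const -[_ *+ _]mulr_natr.
have -> : #|[pred i | p s == p i]| = #|[set t | p t == p s]|.
  by apply: eq_card => t; rewrite !inE eq_sym.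
by rewrite -/(N s) divfK.
Qed.

Lemma cond_mean_bounds (R : realFieldType) (T K : finType) (p : T -> K)
    (f : T -> R) (t : T) :
  (forall s, 0 <= f s <= 1) -> 0 <= cond_mean p f t <= 1.
Proof.
move=> f01; rewrite /cond_mean.
set N : R := _%:R.
have N0 : 0 < N.
  by rewrite /N ltr0n; apply/card_gt0P; exists t; rewrite inE.
rewrite divr_ge0 ?(ltW N0) ?sumr_ge0 //=; last first.
  by move=> s _; case/andP: (f01 s).
rewrite ler_pdivrMr // mul1r.
apply: le_trans (ler_sum _ (F := f) (G := fun=> 1) _) _.
  by move=> s _; case/andP: (f01 s).
rewrite sumr_const /N ler_nat; apply: eq_leq; apply: eq_card => s.
by rewrite !inE.
Qed.

(** The squared norm of the conditional mean, not divided by [#|T|]; on pairs of vertices it is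
    compared with [#|V| ^ 2]. *)
Definition mean_energy {R : realFieldType} {T K : finType} (p : T -> K)
    (f : T -> R) : R := \sum_t cond_mean p f t ^+ 2.

(* Pythagoras for the nested conditional means, with the square of the
   difference bounded below by its linearisation at [- h]. *)
Lemma mean_energy_gain (R : realFieldType) (T K L : finType) (p : T -> K)
    (q : T -> L) (f h : T -> R) :
  (forall s t, q s = q t -> p s = p t) ->
  (forall s t, q s = q t -> h s = h t) ->
  mean_energy p f + \sum_t (2 * cond_mean p f t * h t - 2 * f t * h t - h t ^+ 2)
    <= mean_energy q f.
Proof.
move=> qp qh; rewrite /mean_energy.
set cp := cond_mean p f; set cq := cond_mean q f.
have cpE s t : p s = p t -> cp s = cp t by move=> st; rewrite /cp /cond_mean st.
have t1 : \sum_t cq t * h t = \sum_t f t * h t by exact: cond_mean_tower.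
have t2 : \sum_t cq t * cp t = \sum_t f t * cp t.
  by apply: cond_mean_tower => s t /qp; exact: cpE.
have t3 : \sum_t cp t * cp t = \sum_t f t * cp t by exact: cond_mean_tower.
have : 0 <= \sum_t (cq t - cp t + h t) ^+ 2.
  by apply: sumr_ge0 => t _; exact: sqr_ge0.
have -> : \sum_t (cq t - cp t + h t) ^+ 2 = \sum_t cq t ^+ 2 + \sum_t cp t * cp t
   + \sum_t h t ^+ 2 + (- 2) * \sum_t cq t * cp t + 2 * \sum_t cq t * h t
   + (- 2) * \sum_t cp t * h t.
  by rewrite !mulr_sumr -!big_split /=; apply: eq_bigr => t _; ring.
have -> : \sum_t (2 * cp t * h t - 2 * f t * h t - h t ^+ 2) =
    2 * \sum_t cp t * h t + (- 2) * \sum_t f t * h t + (- 1) * \sum_t h t ^+ 2.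
  by rewrite !mulr_sumr -!big_split /=; apply: eq_bigr => t _; ring.
have -> : \sum_t cp t ^+ 2 = \sum_t cp t * cp t.
  by apply: eq_bigr => t _; rewrite expr2.
rewrite t1 t2 -t3; lra.
Qed.

(** Ordered pairs are counted: an edge inside the intersection of [X] and [Y] counts twice. *)
Definition edge_count {V : finType} (G : sgraph V) (X Y : {set V}) : nat :=
  \sum_(x in X) #|[set y in Y | adj G x y]|.

(** One-sided regularity, without an upper bound on densities. This is what a greedy embedding uses,
    and a violation raises the energy as soon as the pair itself has density at least [2 * d]. *)
Definition lower_regular {R : realType} {V : finType} (G : sgraph V)
    (eps d : R) (A B : {set V}) : bool :=
  [forall X : {set V}, forall Y : {set V},
     [&& X \subset A, Y \subset B, eps * #|A|%:R <= #|X|%:R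
       & eps * #|B|%:R <= #|Y|%:R] ==>
     (d * #|X|%:R * #|Y|%:R <= (edge_count G X Y)%:R)].

Definition fibre {V L : finType} (P : V -> L) (i : L) : {set V} := P @^-1: [set i].

Definition irregular_edges {R : realType} {V L : finType} (G : sgraph V)
    (eps d : R) (P : V -> L) : {set V * V} :=
  [set t | adj G t.1 t.2 &&
     ~~ lower_regular G eps d (fibre P (P t.1)) (fibre P (P t.2))].

Definition pair_map {V L : finType} (P : V -> L) (t : V * V) : L * L :=
  (P t.1, P t.2).

Definition adj_ind {R : realType} {V : finType} (G : sgraph V) (t : V * V) : R :=
  (adj G t.1 t.2)%:R.

Definition index_energy {R : realType} {V L : finType} (G : sgraph V) (P : V -> L) : R :=
  mean_energy (pair_map P) (adj_ind G).

Lemma adj_ind01 (R : realType) (V : finType) (G : sgraph V) (t : V * V) :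
  0 <= (adj_ind G t : R) <= 1.
Proof. by rewrite /adj_ind; case: (adj G _ _); rewrite /= ?lexx ler01. Qed.

Lemma index_energy_le (R : realType) (V L : finType) (G : sgraph V) (P : V -> L) :
  (index_energy G P : R) <= #|V|%:R ^+ 2.
Proof.
rewrite /index_energy /mean_energy.
apply: (@le_trans _ _ (\sum_(t : V * V) 1)); last first.
  by rewrite sumr_const card_prod natrM expr2.
apply: ler_sum => t _.
have /andP[m0 m1] := @cond_mean_bounds R _ _ (pair_map P) _ t (adj_ind01 R G).
by rewrite expr_le1.
Qed.

Lemma edge_count_pairs (V : finType) (G : sgraph V) (X Y : {set V}) :
  edge_count G X Y = #|[set t in setX X Y | adj G t.1 t.2]|.
Proof.
rewrite /edge_count -sum1_card (eq_bigl (fun t => (t.1 \in X) &&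
  ((t.2 \in Y) && adj G t.1 t.2))); last by case=> x y; rewrite !inE /= andbA.
rewrite -(pair_big_dep (mem X) (fun x y => (y \in Y) && adj G x y) (fun _ _ => 1%N)) /=.
apply: eq_bigr => x _; rewrite -sum1_card; apply: eq_bigl => y.
by rewrite inE.
Qed.

Lemma pair_map_fibre (V L : finType) (P : V -> L) (ij : L * L) (t : V * V) :
  (pair_map P t == ij) = (t \in setX (fibre P ij.1) (fibre P ij.2)).
Proof. by case: ij t => i j [x y]; rewrite !inE /= xpair_eqE. Qed.

Lemma edge_count_le (V : finType) (G : sgraph V) (X Y : {set V}) :
  (edge_count G X Y <= #|X| * #|Y|)%N.
Proof.
rewrite edge_count_pairs -cardsX; apply: subset_leq_card.
by apply/subsetP => t; rewrite inE => /andP[].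
Qed.

Lemma sum_fibre_pairs (V L : finType) (P : V -> L) :
  (\sum_ij #|fibre P ij.1| * #|fibre P ij.2| = #|V| ^ 2)%N.
Proof.
rewrite expnS expn1 -card_prod -sum1_card.
rewrite (partition_big (pair_map P) xpredT) //=; apply: eq_bigr => ij _.
by rewrite -cardsX -sum1_card; apply: eq_bigl => t; rewrite pair_map_fibre.
Qed.

Lemma cond_mean_pair (R : realType) (V L : finType) (G : sgraph V) (P : V -> L)
    (t : V * V) :
  cond_mean (pair_map P) (adj_ind G) t =
  (edge_count G (fibre P (P t.1)) (fibre P (P t.2)))%:R /
  (#|fibre P (P t.1)| * #|fibre P (P t.2)|)%:R :> R.
Proof.
rewrite /cond_mean; congr (_ / _%:R).
  rewrite edge_count_pairs -sum1_card natr_sum.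
  rewrite [RHS](eq_bigl (fun s => (pair_map P s == pair_map P t) && adj G s.1 s.2)).
    by rewrite [RHS]big_mkcondr; apply: eq_bigr => s _; rewrite /adj_ind; case: adj.
  by move=> s; rewrite pair_map_fibre inE.
rewrite -cardsX; apply: eq_card => s.
by rewrite inE pair_map_fibre.
Qed.

Lemma lower_regularPn (R : realType) (V : finType) (G : sgraph V) (eps d : R)
    (A B : {set V}) :
  ~~ lower_regular G eps d A B -> exists XY : {set V} * {set V},
    [/\ [&& XY.1 \subset A, XY.2 \subset B, eps * #|A|%:R <= #|XY.1|%:R
       & eps * #|B|%:R <= #|XY.2|%:R] &
     (edge_count G XY.1 XY.2)%:R < d * #|XY.1|%:R * #|XY.2|%:R].
Proof.
move=> /forallPn[X /forallPn[Y]]; rewrite negb_imply -ltNge => /andP[h1 h2].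
by exists (X, Y).
Qed.

(** Irregular edges in pairs of density below [2 * d] number at most [2 * d * #|V| ^ 2], so the
    denser irregular pairs cover an area of at least [gam * #|V| ^ 2]. In each of them a witness
    rectangle of density below [d] occupies a fraction at least [eps ^ 2]. With [P] refined by the
    witnesses and [h = d] on these rectangles, the gain per unit of their area is at least
    [4 d^2 - 2 d^2 - d^2 = d^2]. *)
Lemma index_energy_increment (R : realType) (eps d gam : R) (M : nat) :
  0 < eps -> 0 < d -> 
  exists M' : nat, forall (V : finType) (G : sgraph V) (P : V -> 'I_M),
  (2 * d + gam) * #|V|%:R ^+ 2 < #|irregular_edges G eps d P|%:R ->
  exists Q : V -> 'I_M',
    index_energy G P + d ^+ 2 * eps ^+ 2 * gam * #|V|%:R ^+ 2 <= index_energy G Q.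
Proof.
move=> eps0 d0.
(* A refined part is labelled by its old part and by the pairs whose first or second witness set
   contains it; the number of labels depends on [M] alone. *)
pose L : finType := ('I_M * {set 'I_M * 'I_M} * {set 'I_M * 'I_M})%type.
exists #|L| => V G P many.
pose cl := fibre P.
pose irr ij := ~~ lower_regular G eps d (cl ij.1) (cl ij.2).
pose violates ij (XY : {set V} * {set V}) := irr ij ->
    [/\ [&& XY.1 \subset cl ij.1, XY.2 \subset cl ij.2,
         eps * #|cl ij.1|%:R <= #|XY.1|%:R & eps * #|cl ij.2|%:R <= #|XY.2|%:R] &
     (edge_count G XY.1 XY.2)%:R < d * #|XY.1|%:R * #|XY.2|%:R].
have [wit witP] : exists wit, forall ij, violates ij (wit ij).
  apply: (fin_all_exists (P := violates)) => ij.
  case irrij : (irr ij); last by exists (set0, set0); rewrite /violates irrij.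
  by have [XY XYP] := lower_regularPn irrij; exists XY.
pose X ij := (wit ij).1; pose Y ij := (wit ij).2.
pose I ij := irr ij && (2 * d * (#|cl ij.1| * #|cl ij.2|)%:R
                          <= (edge_count G (cl ij.1) (cl ij.2))%:R).
have XYs ij : irr ij -> (X ij \subset cl ij.1) && (Y ij \subset cl ij.2).
  by case/witP => /and4P[-> ->].
pose q v : L := (P v, [set ij | v \in X ij], [set ij | v \in Y ij]).
pose ind t : bool := I (pair_map P t) && (t \in setX (X (pair_map P t)) (Y (pair_map P t))).
pose h t : R := d * (ind t)%:R.
exists (fun v => enum_rank (q v)).
rewrite /index_energy.
apply: le_trans (@mean_energy_gain R _ _ _ (pair_map P) _ (adj_ind G) h _ _); last first.
- move=> [s1 s2] [t1 t2] [] /enum_rank_inj[p1 x1 y1] /enum_rank_inj[p2 x2 y2].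
  rewrite /h /ind /pair_map /= p1 p2 !inE /=.
  move/setP/(_ (P t1, P t2)): x1; move/setP/(_ (P t1, P t2)): y2; rewrite !inE => -> ->.
  by [].
- move=> [s1 s2] [t1 t2] [] /enum_rank_inj[p1 _ _] /enum_rank_inj[p2 _ _].
  by rewrite /pair_map /= p1 p2.
rewrite lerD2l.
(* Rectangles of distinct pairs lie in disjoint products of parts, so no [t] is counted twice. *)
have indS (F : V * V -> R) : \sum_t F t * (ind t)%:R =
    \sum_(ij | I ij) \sum_(t in setX (X ij) (Y ij)) F t.
  rewrite (partition_big (pair_map P) xpredT) //= [RHS]big_mkcond /=.
  apply: eq_bigr => ij _; case Iij : (I ij); last first.
    by apply: big1 => t /eqP tij; rewrite /ind tij Iij mulr0.
  rewrite [RHS]big_mkcond [LHS]big_mkcond /=; apply: eq_bigr => t _.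
  case: eqP => [tij|tij].
    by rewrite /ind tij Iij /=; case: (t \in _); rewrite ?mulr1 ?mulr0.
  case: ifP => // tXY; case: tij; apply/eqP; rewrite pair_map_fibre.
  case/andP: Iij => /XYs sXY _; move: tXY; rewrite !inE.
  by case/andP: sXY => /subsetP sX /subsetP sY /andP[/sX + /sY]; rewrite !inE => -> ->.
pose xy ij : R := (#|X ij| * #|Y ij|)%:R.
have sumind : \sum_t (ind t)%:R = \sum_(ij | I ij) xy ij :> R.
  rewrite (eq_bigr (fun t => 1 * (ind t)%:R)) => [|t _]; last by rewrite mul1r.
  rewrite indS; apply: eq_bigr => ij _.
  by rewrite sumr_const cardsX.
have sumadj : \sum_t adj_ind G t * (ind t)%:R <= d * \sum_t (ind t)%:R :> R.
  rewrite indS sumind mulr_sumr; apply: ler_sum => ij /andP[/witP[_ lt_e] _].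
  apply: le_trans (ltW (_ : _ < d * xy ij)) => //.
  rewrite /xy natrM mulrA; apply: le_lt_trans lt_e.
  rewrite edge_count_pairs -sum1_card natr_sum.
  rewrite [leRHS](eq_bigl (fun s => (s \in setX (X ij) (Y ij)) && adj G s.1 s.2)).
    by rewrite [leRHS]big_mkcondr; apply: ler_sum => s _; rewrite /adj_ind; case: adj.
  by move=> s; rewrite !inE.
have summean : 2 * d * \sum_t (ind t)%:R <=
    \sum_t cond_mean (pair_map P) (adj_ind G) t * (ind t)%:R :> R.
  rewrite mulr_sumr; apply: ler_sum => t _; case indt : (ind t); last by rewrite !mulr0.
  rewrite !mulr1 cond_mean_pair.
  case/andP: indt => /andP[_ dense] _; rewrite ler_pdivlMr //.
  rewrite ltr0n muln_gt0; apply/andP; split; apply/card_gt0P.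
    by exists t.1; rewrite !inE.
  by exists t.2; rewrite !inE.
have sizeI : gam * #|V|%:R ^+ 2 <= \sum_(ij | I ij) (#|cl ij.1| * #|cl ij.2|)%:R.
  have tot : \sum_ij (#|cl ij.1| * #|cl ij.2|)%:R = #|V|%:R ^+ 2 :> R.
    by rewrite -natr_sum sum_fibre_pairs natrX.
  move: (ltW many).
  have -> : #|irregular_edges G eps d P|%:R =
      \sum_(ij | irr ij) (edge_count G (cl ij.1) (cl ij.2))%:R :> R.
    rewrite -natr_sum -sum1_card (partition_big (pair_map P) irr) /=; last first.
      by move=> t; rewrite inE => /andP[_].
    congr (_%:R); apply: eq_bigr => ij irrij.
    rewrite edge_count_pairs -sum1_card; apply: eq_bigl => t.
    rewrite [RHS]inE -pair_map_fibre andbC [t \in _]inE.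
    case: (pair_map P t =P ij) => //= tij; move: irrij; rewrite -tij /irr /= => ->.
    by rewrite andbT.
  have : \sum_(ij | irr ij) (edge_count G (cl ij.1) (cl ij.2))%:R <=
     2 * d * (\sum_ij (#|cl ij.1| * #|cl ij.2|)%:R) +
     \sum_(ij | I ij) (#|cl ij.1| * #|cl ij.2|)%:R :> R.
    rewrite mulr_sumr [in leRHS]big_mkcond /= [X in _ <= _ + X]big_mkcond -big_split /=.
    rewrite big_mkcond /=; apply: ler_sum => ij _.
    have c0 : 0 <= (#|cl ij.1| * #|cl ij.2|)%:R :> R by exact: ler0n.
    have dc0 : 0 <= 2 * d * (#|cl ij.1| * #|cl ij.2|)%:R by rewrite mulr_ge0 // mulr_ge0 // ltW.
    rewrite /I; case: (irr ij) => /=; last by rewrite addr0.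
    case: ifP => [_|/negbT]; last by rewrite -ltNge addr0 => /ltW.
    apply: le_trans (_ : (#|cl ij.1| * #|cl ij.2|)%:R <= _); first by rewrite ler_nat edge_count_le.
    by rewrite lerDr.
  rewrite tot => h1 h2; have := le_trans h2 h1; rewrite mulrDl.
  by rewrite lerD2l.
have sizeXY : eps ^+ 2 * (\sum_(ij | I ij) (#|cl ij.1| * #|cl ij.2|)%:R) <=
    \sum_t (ind t)%:R.
  rewrite sumind mulr_sumr; apply: ler_sum => ij /andP[/witP[/and4P[_ _ hx hy] _] _].
  rewrite /xy !natrM expr2 mulrACA; apply: ler_pM => //; rewrite mulr_ge0 //; exact: ltW.
have -> : \sum_t (2 * cond_mean (pair_map P) (adj_ind G) t * h t -
     2 * adj_ind G t * h t - h t ^+ 2) =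
   2 * d * (\sum_t cond_mean (pair_map P) (adj_ind G) t * (ind t)%:R)
   + - (2 * d) * (\sum_t adj_ind G t * (ind t)%:R) + - d ^+ 2 * (\sum_t (ind t)%:R).
  rewrite !mulr_sumr -!big_split /=; apply: eq_bigr => t _; rewrite /h.
  by case: (ind t) => /=; ring.
move: sizeXY sizeI summean sumadj.
move: (\sum_t cond_mean _ _ t * _) (\sum_t adj_ind G t * _) => u v.
move: (\sum_t (ind t)%:R) (\sum_(ij | I ij) _) (#|V|%:R ^+ 2) => w x y h1 h2 h3 h4.
have e2 : 0 <= eps ^+ 2 by exact: sqr_ge0.
have h5 : eps ^+ 2 * (gam * y) <= w by apply: le_trans h1; exact: ler_wpM2l.
have h6 : d ^+ 2 * (eps ^+ 2 * (gam * y)) <= d ^+ 2 * w by apply: ler_wpM2l => //; exact: sqr_ge0.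
have h7 : d * (2 * d * w) <= d * u by apply: ler_wpM2l => //; exact: ltW.
have h8 : d * v <= d * (d * w) by apply: ler_wpM2l => //; exact: ltW.
have -> : d ^+ 2 * eps ^+ 2 * gam * y = d ^+ 2 * (eps ^+ 2 * (gam * y)) by ring.
apply: le_trans h6 _.
have -> : 2 * d * u + - (2 * d) * v + - d ^+ 2 * w = 2 * (d * u) - 2 * (d * v) - d ^+ 2 * w by ring.
have e3 : d * (d * w) = d ^+ 2 * w by ring.
have e4 : d * (2 * d * w) = 2 * (d ^+ 2 * w) by ring.
rewrite e3 in h8; rewrite e4 in h7; lra.
Qed.

(* Szemeredi's lemma for lower-regular pairs; the parts may have different
   sizes, and a part may be paired with itself. *)
Lemma lower_regularity (R : realType) (eps d gam : R) :
  0 < eps -> 0 < d -> 0 < gam ->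
  exists M : nat, forall (V : finType) (G : sgraph V), exists P : V -> 'I_M,
    #|irregular_edges G eps d P|%:R <= (2 * d + gam) * #|V|%:R ^+ 2.
Proof.
move=> eps0 d0 gam0; pose kap := d ^+ 2 * eps ^+ 2 * gam.
have kap0 : 0 < kap by rewrite !mulr_gt0 ?exprn_gt0.
(* Each round either stops with few irregular edges or gains [kap * #|V| ^ 2] of energy. *)
have step (m : nat) : exists M : nat, forall (V : finType) (G : sgraph V),
    exists P : V -> 'I_M,
    #|irregular_edges G eps d P|%:R <= (2 * d + gam) * #|V|%:R ^+ 2 \/
    m%:R * kap * #|V|%:R ^+ 2 <= index_energy G P.
  elim: m => [|m [M IH]].
    exists 1%N => V G; exists (fun=> ord0); right; rewrite mulr0n !mul0r.
    by apply: sumr_ge0 => t _; exact: sqr_ge0.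
  have [M' MP] := index_energy_increment gam M eps0 d0.
  (* One index type has to serve both outcomes; surplus indices are empty parts and do not alter the
     fibres. *)
  exists (maxn M M').
  have lM : (M <= maxn M M')%N by exact: leq_maxl.
  have lM' : (M' <= maxn M M')%N by exact: leq_maxr.
  have fibw N N' (lN : (N <= N')%N) (V : finType) (P : V -> 'I_N) v :
      fibre (fun u => widen_ord lN (P u)) (widen_ord lN (P v)) = fibre P (P v).
    by apply/setP => u; rewrite !inE.
  move=> V G; have [P [few|energy]] := IH V G.
    exists (fun v => widen_ord lM (P v)); left.
    apply: le_trans few; rewrite ler_nat; apply: subset_leq_card.
    by apply/subsetP => t; rewrite !inE !fibw.
  case: (leP (#|irregular_edges G eps d P|%:R) ((2 * d + gam) * #|V|%:R ^+ 2)) => [few|many].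
    exists (fun v => widen_ord lM (P v)); left.
    apply: le_trans few; rewrite ler_nat; apply: subset_leq_card.
    by apply/subsetP => t; rewrite !inE !fibw.
  have [Q energyQ] := MP V G P many.
  exists (fun v => widen_ord lM' (Q v)); right.
  have -> : index_energy G (fun v => widen_ord lM' (Q v)) = index_energy G Q :> R.
    rewrite /index_energy /mean_energy; apply: eq_bigr => t _.
    by rewrite !cond_mean_pair !fibw.
  apply: le_trans energyQ; rewrite -/kap -natr1 mulrDl mul1r mulrDl.
  by rewrite lerD2r.
(* More than [1 / kap] rounds would push the energy above [#|V| ^ 2], unless [V] is empty. *)
have [M MP] := step (Num.bound (kap^-1)).
exists M => V G; have [P [few|energy]] := MP V G; first by exists P.
exists P.
have bnd : 1 < (Num.bound kap^-1)%:R * kap.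
  rewrite -ltr_pdivrMr // mul1r; apply: le_lt_trans (archi_boundP _) => //.
  by rewrite invr_ge0 ltW.
have := le_trans energy (index_energy_le R G P).
case: (posnP #|V|) => [V0 _|V0].
  have -> : irregular_edges G eps d P = set0.
    by apply/setP => t; have := card0_eq V0 t.1; rewrite !inE.
  by rewrite cards0 V0 expr0n mulr0.
by rewrite ger_pMl ?exprn_gt0 ?ltr0n // leNgt bnd.
Qed.

(** * Greedy embedding *)

Lemma leq_card_bigcup (I T : finType) (A : {pred I}) (F : I -> {set T}) :
  (#|\bigcup_(i in A) F i| <= \sum_(i in A) #|F i|)%N.
Proof.
elim/big_rec2: _ => [|i n S _ leS]; first by rewrite cards0.
by apply: leq_trans (leq_card_setU _ _).1 _; rewrite leq_add2l.
Qed.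

(** The vertices compatible with the embedded neighbours of [y]. Images already in use are not
    removed here; they are excluded when a vertex is placed. *)
Definition candidates {U V L : finType} (H : sgraph U) (G : sgraph V)
    (F : L -> {set V}) (ell : U -> L) (D : {set U}) (g : U -> V) (y : U) : {set V} :=
  [set v in F (ell y) | [forall x in D, adj H x y ==> adj G (g x) v]].

(** Placing [x] constrains only its neighbours; as [x] is not in [D], the update leaves [g]
    unchanged on [D]. *)
Lemma candidates_setU1 (U V L : finType) (H : sgraph U) (G : sgraph V)
    (F : L -> {set V}) (ell : U -> L) (D : {set U}) (g : U -> V) (x y : U) (v : V) :
  x \notin D ->
  candidates H G F ell (x |: D) (fun u => if u == x then v else g u) y =
  if adj H x y then [set u in candidates H G F ell D g y | adj G v u]
  else candidates H G F ell D g y.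
Proof.
move=> xD; apply/setP => w.
have -> : (w \in candidates H G F ell (x |: D) (fun u => if u == x then v else g u) y)
   = (w \in candidates H G F ell D g y) && (adj H x y ==> adj G v w).
  rewrite !inE -andbA; congr (_ && _); apply/forall_inP/andP => [h|[/forall_inP h1 h2]].
    split; last by have := h x; rewrite eqxx; apply; rewrite setU11.
    apply/forall_inP => z zD; have := h z; rewrite setU1r // => /(_ isT).
    by case: eqP => // zx; rewrite zx (negPf xD) in zD.
  move=> z; rewrite !inE; case: eqP => [-> //|_ /=]; exact: h1.
by case: (adj H x y); rewrite ?inE ?andbT.
Qed.

(** More than [eps * #|A|] such vertices would form a set [Z] admissible for regularity against [Y],
    yet summing their degrees gives fewer than [d * #|Z| * #|Y|] edges. *)
Lemma card_low_degree (R : realType) (V : finType) (G : sgraph V) (eps d : R)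
    (A B X Y : {set V}) :
  lower_regular G eps d A B -> X \subset A -> Y \subset B ->
  0 <= eps -> eps * #|B|%:R <= #|Y|%:R ->
  #|[set v in X | #|[set u in Y | adj G v u]|%:R < d * #|Y|%:R]|%:R <= eps * #|A|%:R.
Proof.
move=> reg XA YB eps0 Ylarge; set Z := [set v in X | _].
have [->|[z zZ]] := set_0Vmem Z; first by rewrite cards0 mulr_ge0.
rewrite leNgt; apply/negP => /ltW Zlarge.
have ZA : Z \subset A.
  by apply: subset_trans XA; apply/subsetP => v; rewrite inE => /andP[].
move/forallP/(_ Z)/forallP/(_ Y)/implyP: reg.
rewrite ZA YB Zlarge Ylarge => /(_ isT); apply/negP; rewrite -ltNge /edge_count natr_sum.
have -> : d * #|Z|%:R * #|Y|%:R = \sum_(v in Z) d * #|Y|%:R.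
  by rewrite sumr_const -[RHS]mulr_natr mulrAC.
rewrite (bigD1 z) //= [ltRHS](bigD1 z) //=.
have low v : v \in Z -> #|[set u in Y | adj G v u]|%:R < d * #|Y|%:R.
  by rewrite inE => /andP[].
apply: ltr_leD; first exact: low.
by apply: ler_sum => v /andP[/low /ltW].
Qed.

(* Vertices are embedded one at a time; avoiding the vertices of low degree
   into the candidate sets of later neighbours keeps each candidate set from
   shrinking by more than a factor [d] per embedded neighbour. *)
Lemma greedy_embedding (R : realType) (U V L : finType) (H : sgraph U)
    (G : sgraph V) (P F : L -> {set V}) (ell : U -> L) (C : {set U})
    (Delta : nat) (eps d eta : R) (v0 : V) :
  0 <= eps -> 0 < d <= 1 -> 0 <= eta -> eps <= d ^+ Delta * eta ->
  (forall u, degree H u <= Delta)%N ->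
  (forall u u', u \in C -> u' \in C -> adj H u u' ->
     lower_regular G eps d (P (ell u)) (P (ell u'))) ->
  (forall i, F i \subset P i) ->
  (forall u, u \in C -> eta * #|P (ell u)|%:R <= #|F (ell u)|%:R) ->
  (forall u, u \in C -> #|C|%:R + Delta%:R * (eps * #|P (ell u)|%:R) <=
     d ^+ Delta * eta * #|P (ell u)|%:R) ->
  exists g : U -> V, [/\ {in C &, injective g},
    (forall u, u \in C -> g u \in F (ell u)) &
    (forall u u', u \in C -> u' \in C -> adj H u u' -> adj G (g u) (g u'))].
Proof.
move=> eps0 /andP[d0 d1] eta0 epsle degH reg FP Flarge room.
have dpow j : (j <= Delta)%N -> d ^+ Delta <= d ^+ j.
  by move=> jD; apply: ler_wiXn2l => //; exact: ltW.
pose nb (D : {set U}) y := #|[set x in D | adj H x y]|.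
have nbD D y : (nb D y <= Delta)%N.
  apply: leq_trans (degH y); apply: subset_leq_card; apply/subsetP => x.
  by rewrite !inE adj_sym => /andP[].
(* Invariant: the candidate set of an unplaced [y] keeps a fraction [d ^ j] of [F (ell y)], where
   [j <= Delta] counts its placed neighbours. *)
suff main (m : nat) : (m <= #|C|)%N -> exists (D : {set U}) (g : U -> V),
    [/\ D \subset C /\ #|D| = m, {in D &, injective g},
      (forall u, u \in D -> g u \in F (ell u)),
      (forall u u', u \in D -> u' \in D -> adj H u u' -> adj G (g u) (g u')) &
      (forall y, y \in C :\: D ->
         d ^+ nb D y * #|F (ell y)|%:R <= #|candidates H G F ell D g y|%:R)].
  have [D [g [[DC cD] g1 g2 g3 _]]] := main #|C| (leqnn _).
  have DE : D = C by apply/eqP; rewrite eqEcard DC cD leqnn.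
  by exists g; rewrite DE in g1 g2 g3.
elim: m => [_|m IH mC].
  exists set0, (fun=> v0); split.
  - by rewrite sub0set cards0.
  - by move=> x y; rewrite inE.
  - by move=> x; rewrite inE.
  - by move=> x y; rewrite inE.
  - move=> y _; have -> : nb set0 y = 0%N.
      by apply: eq_card0 => x; rewrite !inE.
    rewrite expr0 mul1r ler_nat; apply: subset_leq_card; apply/subsetP => v vF.
    by rewrite inE vF; apply/forall_inP => x; rewrite inE.
have [D [g [[DC cD] g1 g2 g3 g4]]] := IH (ltnW mC).
have [x] : exists x, x \in C :\: D.
  apply/card_gt0P; rewrite cardsD (setIidPr DC) cD subn_gt0; exact: mC.
move=> /[dup] xCD /setDP[xC xD].
pose cand := candidates H G F ell D g.
have candP y : cand y \subset P (ell y).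
  apply: subset_trans (FP _); apply/subsetP => v.
  by rewrite inE => /andP[].
have candF y : y \in C :\: D -> d ^+ Delta * eta * #|P (ell y)|%:R <= #|cand y|%:R.
  move=> yCD; apply: le_trans (g4 y yCD).
  have yC : y \in C by case/setDP: yCD.
  rewrite -mulrA; apply: ler_pM.
  - by rewrite exprn_ge0 // ltW.
  - by rewrite mulr_ge0.
  - exact: dpow.
  - exact: Flarge.
pose bad y := [set v in cand x | #|[set u in cand y | adj G v u]|%:R < d * #|cand y|%:R].
pose later := [set y in C :\: D | adj H x y].
have badS y : y \in later -> #|bad y|%:R <= eps * #|P (ell x)|%:R.
  rewrite inE => /andP[yCD xy]; have yC : y \in C by case/setDP: yCD.
  apply: (card_low_degree (B := P (ell y))) => //; first exact: reg.
  apply: le_trans (candF y yCD); exact: ler_wpM2r.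
(* Fewer than [#|C|] images are in use, and each of at most [Delta] unplaced neighbours of [x]
   forbids at most [eps * #|P (ell x)|] vertices; by [room] some candidate is left. *)
pose forbidden := (g @: D) :|: \bigcup_(y in later) bad y.
have [v vx vf] : exists2 v, v \in cand x & v \notin forbidden.
  apply/subsetPn; apply/negP => /subset_leq_card.
  rewrite leqNgt => /negP; apply.
  rewrite -(ltr_nat R).
  apply: lt_le_trans (candF x xCD); apply: lt_le_trans (room x xC).
  apply: (@le_lt_trans _ _ (#|D|%:R + Delta%:R * (eps * #|P (ell x)|%:R))).
    apply: (@le_trans _ _ (#|g @: D|%:R + #|\bigcup_(y in later) bad y|%:R)).
      by rewrite -natrD ler_nat leq_card_setU.
    apply: lerD; first by rewrite ler_nat leq_imset_card.
    apply: (@le_trans _ _ (\sum_(y in later) #|bad y|%:R)).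
      by rewrite -natr_sum ler_nat leq_card_bigcup.
    apply: (@le_trans _ _ (\sum_(y in later) eps * #|P (ell x)|%:R)).
      by apply: ler_sum => y; exact: badS.
    rewrite sumr_const -[leLHS]mulr_natl; apply: ler_wpM2r; first by rewrite mulr_ge0.
    rewrite ler_nat; apply: leq_trans (degH x); apply: subset_leq_card.
    by apply/subsetP => y; rewrite !inE => /andP[].
  by rewrite ltrD2r ltr_nat cD.
have vnD : v \notin g @: D by apply: contra vf => vD; rewrite inE vD.
have vbad y : y \in later -> v \notin bad y.
  move=> yl; apply: contra vf => vb; rewrite inE; apply/orP; right.
  by apply/bigcupP; exists y.
have vadj u : u \in D -> adj H u x -> adj G (g u) v.
  move=> uD ux; move: vx; rewrite inE => /andP[_ /forall_inP/(_ u uD)].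
  by rewrite ux.
have vF : v \in F (ell x) by move: vx; rewrite inE => /andP[].
have Dx u : u \in D -> (u == x) = false by move=> uD; apply: contraNF xD => /eqP <-.
exists (x |: D), (fun u => if u == x then v else g u); split.
- split; last by rewrite cardsU1 xD cD.
  by apply/subsetP => u; rewrite !inE => /predU1P[->//|]; move/subsetP: DC; apply.
- move=> u u'; rewrite !inE => /predU1P[->|uD] /predU1P[->|u'D] //=; rewrite ?eqxx ?Dx //.
  + by move=> vE; case/imsetP: vnD; exists u'.
  + by move=> vE; case/imsetP: vnD; exists u.
  + exact: g1.
- move=> u; rewrite !inE => /predU1P[->|uD]; rewrite ?eqxx ?Dx //.
  exact: g2.
- move=> u u'; rewrite !inE => /predU1P[->|uD] /predU1P[->|u'D]; rewrite ?eqxx ?Dx //.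
  + by rewrite adj_irr.
  + by rewrite adj_sym => h; rewrite adj_sym; exact: vadj.
  + exact: vadj.
  + exact: g3.
- move=> y /setDP[yC]; rewrite !inE => /norP[yx yD].
  have yCD : y \in C :\: D by rewrite inE yD.
  rewrite candidates_setU1 //.
  have nbx : nb (x |: D) y = (adj H x y + nb D y)%N.
    case xy : (adj H x y).
      rewrite /nb [LHS](_ : _ = #|x |: [set z in D | adj H z y]|).
        by rewrite cardsU1 inE (negPf xD).
      apply: eq_card => z; rewrite !inE andb_orl.
      by case: (z =P x) => [->|//]; rewrite xy.
    apply: eq_card => z; rewrite !inE andb_orl.
    by case: (z =P x) => [->|//]; rewrite xy (negPf xD).
  rewrite nbx; case xy : (adj H x y); last exact: g4.
  have ylater : y \in later by rewrite inE yCD xy.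
  move: (vbad y ylater); rewrite /bad inE vx /= -leNgt.
  apply: le_trans; rewrite exprS -mulrA; apply: ler_wpM2l; first exact: ltW.
  exact: g4.
Qed.

(** Components are inserted one at a time. Images lying in cluster [i] come from vertices labelled
    [i], so by the load bound a fraction [eta] of the cluster is always free, and the greedy
    embedding is applied to these free parts. *)
Lemma component_embedding (R : realType) (U V L : finType) (H : sgraph U)
    (G : sgraph V) (P : V -> L) (ell : U -> L)
    (Delta : nat) (eps d eta K : R) (v0 : V) :
  0 <= eps -> 0 < d <= 1 -> 0 <= eta -> eps <= d ^+ Delta * eta ->
  (forall u, degree H u <= Delta)%N ->
  (forall u u', adj H u u' ->
     lower_regular G eps d (fibre P (ell u)) (fibre P (ell u'))) ->
  (forall i, #|fibre ell i|%:R <= (1 - eta) * #|fibre P i|%:R) ->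
  (forall u, #|[set u' | connect (adj H) u u']|%:R <= K) ->
  (forall u, K + Delta%:R * (eps * #|fibre P (ell u)|%:R) <=
     d ^+ Delta * eta * #|fibre P (ell u)|%:R) ->
  contained_in H G.
Proof.
move=> eps0 d01 eta0 epsle degH reg load compK room.
have symH : connect_sym (adj H) by apply: sym_connect_sym; exact: adj_sym.
(* The union of the components meeting [s]; the induction runs over an enumeration of the vertices
   and skips those already covered. *)
pose dom (s : seq U) := [set u | has (fun x => connect (adj H) x u) s].
suff main (s : seq U) : exists f : U -> V,
    [/\ {in dom s &, injective f}, (forall u, u \in dom s -> P (f u) = ell u) &
     forall u u', u \in dom s -> u' \in dom s -> adj H u u' -> adj G (f u) (f u')].
  have [f [f1 _ f3]] := main (enum U).
  have domT u : u \in dom (enum U).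
    by rewrite inE; apply/hasP; exists u; rewrite ?mem_enum ?connect0.
  by exists f; split=> [x y|x y]; [apply: f1 | apply: f3].
elim: s => [|x s [f [f1 f2 f3]]].
  by exists (fun=> v0); split=> [u u'|u|u u']; rewrite inE.
pose C := [set u | connect (adj H) x u].
have domE : dom (x :: s) = C :|: dom s by apply/setP => u; rewrite !inE.
have dom_closed u u' : adj H u u' -> u \in dom s -> u' \in dom s.
  move=> uu'; rewrite !inE => /hasP[y ys yu]; apply/hasP; exists y => //.
  exact: connect_trans yu (connect1 uu').
case xs : (x \in dom s).
  exists f; suff -> : dom (x :: s) = dom s by [].
  rewrite domE; apply/setUidPr/subsetP => u; rewrite inE => xu.
  move: xs; rewrite !inE => /hasP[y ys yx]; apply/hasP; exists y => //.
  exact: connect_trans yx xu.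
have disj u : u \in C -> u \in dom s -> False.
  rewrite inE => xu; rewrite inE => /hasP[y ys yu]; move: xs; rewrite inE.
  move/negP; apply; apply/hasP; exists y => //; apply: connect_trans yu _.
  by rewrite symH.
pose F i := fibre P i :\: f @: dom s.
have [] := @greedy_embedding R U V L H G (fibre P) F ell C Delta eps d eta v0.
- by [].
- by [].
- by [].
- by [].
- by [].
- by move=> u u' _ _; exact: reg.
- by move=> i; exact: subsetDl.
- move=> u _; rewrite /F cardsD natrB; last by rewrite subset_leq_card // subsetIl.
  rewrite lerBrDr -lerBrDl; apply: le_trans (_ : #|fibre ell (ell u)|%:R <= _).
    rewrite ler_nat; apply: leq_trans (leq_imset_card f _).
    apply: subset_leq_card; apply/subsetP => v; rewrite !inE => /andP[/eqP Pv].
    case/imsetP => w wD vE; apply/imsetP; exists w => //.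
    by rewrite !inE -Pv vE f2.
  by apply: le_trans (load _) _; rewrite mulrBl mul1r.
- move=> u _; apply: le_trans (room u); rewrite lerD2r; exact: compK.
move=> g [g1 g2 g3].
have gP u : u \in C -> P (g u) = ell u /\ g u \notin f @: dom s.
  by move/g2; rewrite !inE => /andP[-> /eqP].
exists (fun u => if u \in C then g u else f u); rewrite domE; split.
- move=> u u'; rewrite ![_ \in _ :|: _]inE.
  case uC : (u \in C); case u'C : (u' \in C) => //= us us'.
  + exact: g1.
  + by move=> E; have [_ /imsetP[]] := gP u uC; exists u'.
  + by move=> E; have [_ /imsetP[]] := gP u' u'C; exists u.
  + exact: f1.
- move=> u; rewrite [_ \in _ :|: _]inE; case uC : (u \in C) => /= us.
    by case: (gP u uC).
  exact: f2.
- move=> u u'; rewrite ![_ \in _ :|: _]inE.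
  case uC : (u \in C); case u'C : (u' \in C) => //= us us' uu'.
  + exact: g3.
  + by case: (disj u uC); apply: dom_closed us'; rewrite adj_sym.
  + by case: (disj u' u'C); apply: dom_closed us.
  + exact: f3.
Qed.

(** * Balanced allocation of components *)

(** Otherwise [p o * (g o - A)] is nonnegative everywhere and positive on the support of [p], while
    its sum is at most zero. The condition [0 < p o] keeps the choice inside the support. *)
Lemma weighted_average_choice (R : realFieldType) (O : finType) (p g : O -> R) (A : R) :
  (forall o, 0 <= p o) -> \sum_o p o = 1 -> \sum_o p o * g o <= A ->
  exists o, 0 < p o /\ g o <= A.
Proof.
move=> p0 p1 le_A.
case: (boolP [exists o, (0 < p o) && (g o <= A)]) => [/existsP[o /andP[]]|none].
  by exists o.
have above o : 0 <= p o * (g o - A) /\ (0 < p o -> 0 < p o * (g o - A)).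
  have := p0 o; rewrite le_eqVlt => /predU1P[<-|po]; first by rewrite mul0r ltxx.
  have gA : A < g o.
    rewrite ltNge; apply: contra none => goA; apply/existsP; exists o.
    by rewrite po.
  by split=> [|_]; [rewrite ltW // |]; rewrite mulr_gt0 // subr_gt0.
have : \sum_o p o * (g o - A) <= 0.
  rewrite (eq_bigr (fun o => p o * g o - p o * A)) => [|o _]; last by rewrite mulrBr.
  by rewrite sumrB -mulr_suml p1 mul1r subr_le0.
move=> le0.
have all0 : \sum_o p o * (g o - A) = 0.
  by apply/eqP; rewrite eq_le le0 sumr_ge0 // => o _; case: (above o).
have p_0 o : p o = 0.
  have := psumr_eq0P (fun o _ => (above o).1) all0 (i := o) isT.
  have := p0 o; rewrite le_eqVlt => /predU1P[<- //|po].
  by move=> E; have := (above o).2 po; rewrite E ltxx.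
by move: p1; rewrite big1 // => /esym/eqP; rewrite oner_eq0.
Qed.

(* Choosing each option so that the sum of squared discrepancies grows at most
   by its mean growth, in which the cross terms vanish. *)
Lemma vector_balancing (R : realFieldType) (I : eqType) (O L : finType) (p : O -> R)
    (v : I -> O -> L -> R) (s : seq I) :
  (forall o, 0 <= p o) -> \sum_o p o = 1 -> uniq s ->
  exists c : I -> O, (forall x, 0 < p (c x)) /\
    \sum_l (\sum_(x <- s) (v x (c x) l - \sum_o p o * v x o l)) ^+ 2 <=
    \sum_(x <- s) \sum_o p o * \sum_l v x o l ^+ 2.
Proof.
move=> p0 p1; elim: s => [_|x s IH /= /andP[xs us]].
  have [|o [po _]] := @weighted_average_choice R O p (fun=> 0) 0 p0 p1.
    by rewrite big1 // => o _; rewrite mulr0.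
  exists (fun=> o); split=> //; rewrite big_nil big1 // => l _.
  by rewrite big_nil expr0n.
have [c [c0 cle]] := IH us.
pose D l := \sum_(y <- s) (v y (c y) l - \sum_o p o * v y o l).
pose m l := \sum_o p o * v x o l.
have mean : \sum_o p o * (\sum_l (v x o l - m l + D l) ^+ 2) <=
   \sum_o p o * (\sum_l v x o l ^+ 2) + \sum_l D l ^+ 2.
  under eq_bigr do rewrite mulr_sumr.
  under [X in _ <= X + _]eq_bigr do rewrite mulr_sumr.
  rewrite exchange_big [X in _ <= X + _]exchange_big -big_split /=.
  apply: ler_sum => l _.
  have -> : \sum_o p o * (v x o l - m l + D l) ^+ 2 =
     \sum_o p o * v x o l ^+ 2 + 2 * (D l - m l) * (\sum_o p o * v x o l)
     + (D l - m l) ^+ 2 * (\sum_o p o).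
    by rewrite !mulr_sumr -!big_split /=; apply: eq_bigr => o _; ring.
  rewrite p1 -/(m l) -addrA lerD2l.
  (* The two sides differ by exactly [m l ^+ 2]. *)
  have := sqr_ge0 (m l); lra.
have [o [po ole]] := weighted_average_choice p0 p1 mean.
exists (fun y => if y == x then o else c y); split; first by move=> y; case: ifP.
rewrite big_cons; apply: le_trans (_ : \sum_l (v x o l - m l + D l) ^+ 2 <= _).
  apply: ler_sum => l _; rewrite big_cons eqxx le_eqVlt; apply/orP; left; apply/eqP.
  congr ((_ + _) ^+ 2); apply: eq_big_seq => y ys.
  by case: eqP => // yx; rewrite -yx ys in xs.
apply: le_trans ole _; rewrite lerD2l; exact: cle.
Qed.

(** Substitute [tperm i j * s] for [s]; products of permutations apply the left factor first. *)
Lemma perm_average_sym (R : realFieldType) (k : nat) (u : {perm 'I_k} -> R)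
    (g : 'I_k -> R) (i j : 'I_k) :
  (forall s, u (tperm i j * s)%g = u s) ->
  \sum_s u s * g (s i) = \sum_s u s * g (s j).
Proof.
move=> usym; rewrite (reindex_inj (mulgI (tperm i j))) /=.
by apply: eq_bigr => s _; rewrite usym permM tpermL.
Qed.

Lemma perm_average_sum (R : realFieldType) (k : nat) (u : {perm 'I_k} -> R)
    (g : 'I_k -> R) :
  \sum_i \sum_s u s * g (s i) = (\sum_s u s) * \sum_i g i.
Proof.
rewrite exchange_big mulr_suml; apply: eq_bigr => s _.
by rewrite -mulr_sumr [in RHS](reindex_inj (@perm_inj _ s)).
Qed.

(** The uniform law on all permutations gives [g (s ord0)] the mean [N / k.+1], the uniform law on
    those fixing [ord0] gives it the mean [g ord0]. Since [A] lies between the two, a convex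
    combination attains it; by symmetry the remaining indices share [N - A] equally. *)
Lemma perm_weights (R : realFieldType) (k : nat) (g : 'I_k.+1 -> R) (A : R) :
  g ord0 <= A -> A * k.+1%:R <= \sum_i g i ->
  exists u : {perm 'I_k.+1} -> R, [/\ (forall s, 0 <= u s), \sum_s u s = 1 &
    forall i, \sum_s u s * g (s i) =
      if i == ord0 then A else (\sum_i g i - A) / k%:R].
Proof.
move=> gA AN; pose N := \sum_i g i.
pose u1 (s : {perm 'I_k.+1}) : R := (#|{perm 'I_k.+1}|%:R)^-1.
pose fix0 := [set s : {perm 'I_k.+1} | s ord0 == ord0].
pose u2 (s : {perm 'I_k.+1}) : R := (s \in fix0)%:R / #|fix0|%:R.
have n1 : #|{perm 'I_k.+1}|%:R != 0 :> R.
  by rewrite pnatr_eq0 -lt0n; apply/card_gt0P; exists 1%g.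
have n2 : #|fix0|%:R != 0 :> R.
  by rewrite pnatr_eq0 -lt0n; apply/card_gt0P; exists 1%g; rewrite inE perm1.
have u1s : \sum_s u1 s = 1 by rewrite /u1 sumr_const -[LHS]mulr_natl mulfV.
have u2s : \sum_s u2 s = 1.
  by rewrite /u2 -mulr_suml -natr_sum -big_mkcond /= sum1_card mulfV.
have u1g : \sum_s u1 s * g (s ord0) = N / k.+1%:R.
  have := perm_average_sum u1 g; rewrite u1s mul1r -/N => <-.
  rewrite [in RHS](eq_bigr (fun=> \sum_s u1 s * g (s ord0))) => [|i _]; last first.
    exact: (@perm_average_sym R _ u1 g i ord0).
  by rewrite sumr_const card_ord -[X in X / _]mulr_natr mulfK ?pnatr_eq0.
have u2g : \sum_s u2 s * g (s ord0) = g ord0.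
  rewrite (eq_bigr (fun s => u2 s * g ord0)) => [|s _]; first by rewrite -mulr_suml u2s mul1r.
  by rewrite /u2 inE; case: eqP => [-> //|_]; rewrite !mul0r.
have [t t01 tE] : exists2 t : R, 0 <= t <= 1 & t * (N / k.+1%:R) + (1 - t) * g ord0 = A.
  have AN' : A <= N / k.+1%:R by rewrite ler_pdivlMr ?ltr0n.
  have := le_trans gA AN'; rewrite le_eqVlt => /predU1P[E|lt].
    exists 0; first by rewrite lexx ler01.
    by rewrite mul0r add0r subr0 mul1r; apply/eqP; rewrite eq_le gA {1}E AN'.
  have lt' : 0 < N / k.+1%:R - g ord0 by rewrite subr_gt0.
  exists ((A - g ord0) / (N / k.+1%:R - g ord0)).
    by rewrite ler_pdivrMr // mul1r lerD2r AN' divr_ge0 ?subr_ge0 // ltW.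
  move: lt'; move: (N / _) => x lt'; field; exact: lt0r_neq0.
case/andP: t01 => t0 t1.
pose u s := t * u1 s + (1 - t) * u2 s.
have ug i : \sum_s u s * g (s i) =
    t * (\sum_s u1 s * g (s i)) + (1 - t) * (\sum_s u2 s * g (s i)).
  by rewrite !mulr_sumr -big_split /=; apply: eq_bigr => s _; rewrite /u; ring.
have us1 : \sum_s u s = 1.
  by rewrite /u big_split /= -!mulr_sumr u1s u2s; ring.
have ug0 : \sum_s u s * g (s ord0) = A by rewrite ug u1g u2g.
exists u; split=> //.
  move=> s; rewrite addr_ge0 // mulr_ge0 ?subr_ge0 // /u1 /u2 ?invr_ge0 //.
  by rewrite divr_ge0.
move=> i; case: eqP => [-> //|/eqP i0].
(* Transposing two nonzero colours preserves both laws. *)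
have sym j : j != ord0 -> \sum_s u s * g (s j) = \sum_s u s * g (s i).
  move=> j0; apply: (@perm_average_sym R _ u g j i) => s; rewrite /u /u1 /u2 !inE permM.
  by rewrite tpermD // eq_sym.
(* An index other than [ord0] exists only for positive [k]. *)
have k0 : k%:R != 0 :> R.
  rewrite pnatr_eq0; apply: contra i0 => /eqP k0; apply/eqP/val_inj => /=.
  by have := leq_ord i; rewrite {2}k0 leqn0 => /eqP.
apply: (mulIf k0); rewrite divfK // -/N.
have := perm_average_sum u g; rewrite us1 mul1r -/N => <-.
rewrite (bigD1 ord0) //= ug0 addrAC subrr add0r.
rewrite [RHS](eq_bigr (fun=> \sum_s u s * g (s i))) => [|j j0]; last exact: sym.
rewrite sumr_const mulr_natr; congr (_ *+ _).
by rewrite cardC1 card_ord.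
Qed.

(* Every component of [H] is assigned a random tuple of [L] drawn from [w] and
   a random permutation of the colours biased towards fixing colour 0; the
   expected loads are proportional to [a, b, ..., b]. *)
Lemma allocation (R : realFieldType) (k : nat) (U L : finType) (H : sgraph U)
    (f : U -> 'I_k.+1) (w : {ffun 'I_k.+1 -> L} -> R) (a b : R) (cap : L -> R)
    (K : R) :
  let S := a + k%:R * b in
  let wt (i : 'I_k.+1) := if i == ord0 then a else b in
  0 < a -> a <= b ->
  (forall q, 0 <= w q) -> \sum_q w q = 1 ->
  #|fibre f ord0|%:R * S <= a * #|U|%:R ->
  (forall l, \sum_q w q * (\sum_i (q i == l)%:R * wt i) <= S * cap l) ->
  (forall u, #|[set u' | connect (adj H) u u']|%:R <= K) ->
  exists ell : U -> L,
    (forall u, exists q (s : {perm 'I_k.+1}), 0 < w q /\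
       forall u', connect (adj H) u u' -> ell u' = q (s (f u'))) /\
    (forall l c, 0 <= c -> K * #|U|%:R <= c ^+ 2 ->
       #|fibre ell l|%:R <= #|U|%:R * cap l + c).
Proof.
move=> S wt a0 ab w0 w1 f0 load compK.
have b0 : 0 < b by exact: lt_le_trans ab.
have S0 : 0 < S by rewrite ltr_wpDr // mulr_ge0 // ltW.
have symH : connect_sym (adj H) by apply: sym_connect_sym; exact: adj_sym.
(* Components are indexed by all vertices; [comp x] is empty unless [x] is the root representing its
   component. *)
pose comp x := [set y | fingraph.root (adj H) y == x].
pose N : R := #|U|%:R.
pose g (i : 'I_k.+1) : R := #|fibre f i|%:R.
have gN : \sum_i g i = N.
  rewrite -natr_sum /N -sum1_card (partition_big f xpredT) //=; congr _%:R.
  by apply: eq_bigr => i _; rewrite -sum1_card; apply: eq_bigl => y; rewrite !inE.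
have [||u [u0 u1 ug]] := @perm_weights R k g (a * N / S).
- by rewrite ler_pdivlMr.
- rewrite gN mulrAC ler_pdivrMr // mulrAC [leRHS]mulrC; apply: ler_wpM2r => //.
  by rewrite -natr1 mulrDr mulr1 addrC /S lerD2l mulrC; apply: ler_wpM2l.
have ug' i : \sum_s u s * g (s i) = N * wt i / S.
  rewrite ug gN /wt; case: eqP => [_|/eqP i0]; first by rewrite [a * N]mulrC.
  have k0 : k%:R != 0 :> R.
    rewrite pnatr_eq0; apply: contra i0 => /eqP k0; apply/eqP/val_inj => /=.
    by have := leq_ord i; rewrite {2}k0 leqn0 => /eqP.
  have Sn0 : a + k%:R * b != 0 by rewrite -/S lt0r_neq0.
  by rewrite /S; field; rewrite Sn0 k0.
pose O : finType := ({ffun 'I_k.+1 -> L} * {perm 'I_k.+1})%type.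
pose p (o : O) := w o.1 * u o.2.
have sumO (F : {ffun 'I_k.+1 -> L} -> {perm 'I_k.+1} -> R) :
   \sum_(o : O) F o.1 o.2 = \sum_q \sum_s F q s by rewrite pair_big.
have p0 o : 0 <= p o by rewrite mulr_ge0.
have p1 : \sum_o p o = 1.
  rewrite (sumO (fun q s => w q * u s)) -w1; apply: eq_bigr => q _.
  by rewrite -mulr_sumr u1 mulr1.
(* The load of [comp x] on [l] when position [i] of the tuple receives colour class [o.2 i]; thus a
   vertex [y] goes to the position given by the inverse of [o.2] at [f y]. *)
pose v x (o : O) l : R :=
  \sum_i (o.1 i == l)%:R * #|[set y in comp x | f y == o.2 i]|%:R.
have vE x o l : v x o l = #|[set y in comp x | o.1 ((o.2^-1)%g (f y)) == l]|%:R.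
  rewrite -sum1_card (partition_big (fun y => (o.2^-1)%g (f y)) xpredT) //= natr_sum.
  apply: eq_bigr => i _; rewrite -sum1_card !natr_sum [in RHS]big_mkcond /=.
  rewrite [in LHS]big_mkcond mulr_sumr; apply: eq_bigr => y _; rewrite !inE.
  have -> : (f y == o.2 i) = ((o.2^-1)%g (f y) == i).
    by apply/eqP/eqP => [->|<-]; rewrite ?permK ?permKV.
  case: (fingraph.root (adj H) y == x) => /=; rewrite ?mulr0 //.
  case: ((o.2^-1)%g (f y) =P i) => [->|_]; last by rewrite andbF mulr0.
  by rewrite andbT; case: eqP; rewrite ?mul1r ?mul0r.
have compU x : #|comp x|%:R <= K.
  case: (set_0Vmem (comp x)) => [->|[y]].
    by rewrite cards0; apply: le_trans (compK x).
  rewrite inE => /eqP yx; apply: le_trans (compK y); rewrite ler_nat.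
  apply: subset_leq_card; apply/subsetP => z; rewrite !inE -yx => zy.
  by rewrite -(fingraph.root_connect symH) eq_sym.
have compN : \sum_x #|comp x|%:R = N.
  rewrite -natr_sum /N -sum1_card [in RHS](partition_big (fingraph.root (adj H)) xpredT) //=; congr _%:R.
  by apply: eq_bigr => i _; rewrite -sum1_card; apply: eq_bigl => y; rewrite !inE.
have v0 x o l : 0 <= v x o l by rewrite vE.
have vsum x o : \sum_l v x o l = #|comp x|%:R.
  rewrite -sum1_card (partition_big (fun y => o.1 ((o.2^-1)%g (f y))) xpredT) //= natr_sum.
  apply: eq_bigr => l _; rewrite vE -sum1_card; congr _%:R; apply: eq_bigl => y.
  by rewrite !inE.
(* Nonnegative loads with sum [#|comp x|] have squares summing to at most [#|comp x| ^ 2]; over all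
   components this will total at most [K * N]. *)
have vsq x o : \sum_l v x o l ^+ 2 <= K * #|comp x|%:R.
  apply: le_trans (_ : #|comp x|%:R * #|comp x|%:R <= _); last exact: ler_wpM2r.
  rewrite -(vsum x o) mulr_sumr; apply: ler_sum => l _.
  rewrite expr2; apply: ler_wpM2r => //.
  by rewrite (bigD1 l) //= lerDl sumr_ge0.
have [c [c0 cle]] := @vector_balancing R U O L p v (enum U) p0 p1 (enum_uniq U).
exists (fun y => (c (fingraph.root (adj H) y)).1 (((c (fingraph.root (adj H) y)).2^-1)%g (f y))); split.
  move=> y; exists (c (fingraph.root (adj H) y)).1, ((c (fingraph.root (adj H) y)).2^-1)%g; split.
    have := c0 (fingraph.root (adj H) y); rewrite /p lt_neqAle => /andP[].
    rewrite eq_sym mulf_eq0 => /norP[wn0 _ _].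
    by rewrite lt_neqAle eq_sym wn0 w0.
  by move=> z /(fingraph.rootP symH) ->.
set ell := fun y : U => _.
have ellE l : #|fibre ell l|%:R = \sum_x v x (c x) l.
  rewrite -sum1_card (partition_big (fingraph.root (adj H)) xpredT) //= natr_sum.
  apply: eq_bigr => x _; rewrite vE -sum1_card; congr _%:R; apply: eq_bigl => y.
  by rewrite !inE /ell andbC; case: eqP => [->|].
(* Averaging over the permutations gives position [i] a mean of [N * wt i / S] vertices, so only the
   law of the tuple remains. *)
have meanE l : \sum_x \sum_o p o * v x o l =
    \sum_q w q * (\sum_i (q i == l)%:R * (N * wt i / S)).
  rewrite exchange_big /=.
  rewrite (eq_bigr (fun o : O => w o.1 * (u o.2 * \sum_i (o.1 i == l)%:R * g (o.2 i)))).
    rewrite (sumO (fun q s => w q * (u s * \sum_i (q i == l)%:R * g (s i)))).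
    apply: eq_bigr => q _; rewrite -mulr_sumr; congr (_ * _).
    transitivity (\sum_s \sum_i u s * ((q i == l)%:R * g (s i))).
      by apply: eq_bigr => s _; rewrite mulr_sumr.
    rewrite exchange_big /=; apply: eq_bigr => i _; rewrite -ug' mulr_sumr.
    by apply: eq_bigr => s _; ring.
  move=> o _; rewrite -mulr_sumr /p -mulrA; congr (_ * (_ * _)).
  rewrite exchange_big /=; apply: eq_bigr => i _; rewrite -mulr_sumr; congr (_ * _).
  rewrite /g -natr_sum; congr _%:R.
  rewrite -sum1_card [in RHS](partition_big (fingraph.root (adj H)) xpredT) //=.
  apply: eq_bigr => x _; rewrite -sum1_card; apply: eq_bigl => y.
  by rewrite !inE andbC.
move=> l e e0 eK.
have meanle : \sum_x \sum_o p o * v x o l <= N * cap l.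
  rewrite meanE.
  have -> : \sum_q w q * (\sum_i (q i == l)%:R * (N * wt i / S)) =
     (N / S) * \sum_q w q * (\sum_i (q i == l)%:R * wt i).
    rewrite mulr_sumr; apply: eq_bigr => q _; rewrite mulrCA; congr (_ * _).
    by rewrite mulr_sumr; apply: eq_bigr => i _; ring.
  apply: le_trans (_ : N / S * (S * cap l) <= _).
    by apply: ler_wpM2l => //; rewrite divr_ge0 // ltW.
  by rewrite mulrA divfK ?lt0r_neq0.
pose D l := \sum_x (v x (c x) l - \sum_o p o * v x o l).
have Dsq : D l ^+ 2 <= e ^+ 2.
  apply: le_trans eK; apply: le_trans (_ : \sum_l D l ^+ 2 <= _).
    by rewrite [leRHS](bigD1 l) //= lerDl sumr_ge0 // => i _; exact: sqr_ge0.
  apply: le_trans (le_trans _ cle) _.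
    by apply: ler_sum => i _; rewrite big_enum.
  rewrite big_enum -/N -compN mulr_sumr /=.
  apply: ler_sum => x _.
  have -> : K * #|comp x|%:R = \sum_o p o * (K * #|comp x|%:R).
    by rewrite -mulr_suml p1 mul1r.
  by apply: ler_sum => o _; apply: ler_wpM2l.
have De : D l <= e.
  apply: le_trans (ler_norm _) _; rewrite -(ler_pXn2r (n := 2)) ?nnegrE //.
  by rewrite real_normK ?num_real.
have -> : #|fibre ell l|%:R = \sum_x \sum_o p o * v x o l + D l.
  by rewrite ellE /D sumrB addrC subrK.
exact: lerD.
Qed.

(** * Unbalanced colourings *)

Lemma properP (V : finType) (F : sgraph V) (c : nat) (f : {ffun V -> 'I_c}) :
  reflect (forall x y, adj F x y -> f x != f y) (Defs.proper F f).
Proof.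
by apply: (iffP forallP) => h x; [move=> y; have /forallP/(_ y)/implyP := h x
  | apply/forallP => y; apply/implyP; exact: h].
Qed.

(** A binary minimum returns one of its arguments, so an iterated one is its default or one of its
    terms. *)
Lemma alpha_witness (R : realType) (V : finType) (F : sgraph V) :
  alpha R F = 1 \/ exists (f : {ffun V -> 'I_(chromatic_number F)}) i,
    Defs.proper F f /\ alpha R F = #|f @^-1: [set i]|%:R / #|V|%:R.
Proof.
rewrite /alpha; pose Q (x : R) := x = 1 \/
  exists (f : {ffun V -> 'I_(chromatic_number F)}) i,
    Defs.proper F f /\ x = #|f @^-1: [set i]|%:R / #|V|%:R.
have Qmin x y : Q x -> Q y -> Q (Order.min x y) by rewrite /Order.min; case: ifP.
apply: (big_ind Q) => //; first by left.
move=> f pf; apply: (big_ind Q) => //; first by left.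
by move=> i _; right; exists f, i.
Qed.

Lemma alpha_ge0 (R : realType) (V : finType) (F : sgraph V) : 0 <= alpha R F.
Proof.
case: (alpha_witness R F) => [->|[f [i [_ ->]]]]; first exact: ler01.
by rewrite divr_ge0.
Qed.

Lemma alpha_le (R : realType) (V : finType) (F : sgraph V)
    (f : {ffun V -> 'I_(chromatic_number F)}) i :
  Defs.proper F f -> alpha R F <= #|f @^-1: [set i]|%:R / #|V|%:R.
Proof.
move=> pf; rewrite /alpha; apply: (le_trans (bigmin_le_cond (1 : R) _ pf)).
exact: (@bigmin_le_cond _ R _ 1 i xpredT).
Qed.

Lemma chromatic_colourable (V : finType) (F : sgraph V) :
  colourable F (chromatic_number F).
Proof. by rewrite /chromatic_number; case: ex_minnP. Qed.

Lemma chromatic_min (V : finType) (F : sgraph V) (m : nat) :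
  colourable F m -> (chromatic_number F <= m)%N.
Proof. by rewrite /chromatic_number; case: ex_minnP => c _ h; exact: h. Qed.

(** In an optimal proper colouring every class has proportion at least [alpha R F], and the
    proportions add up to 1. *)
Lemma alpha_chromatic_le1 (R : realType) (V : finType) (F : sgraph V) :
  (0 < #|V|)%N -> alpha R F * (chromatic_number F)%:R <= 1.
Proof.
move=> V0; have /existsP[f pf] := chromatic_colourable F.
have n0 : #|V|%:R != 0 :> R by rewrite pnatr_eq0 -lt0n.
apply: le_trans (_ : \sum_(i < chromatic_number F) #|f @^-1: [set i]|%:R / #|V|%:R <= _).
  rewrite mulr_natr -[X in _ *+ X]card_ord -sumr_const; apply: ler_sum => i _.
  exact: alpha_le.
rewrite -mulr_suml -natr_sum.
have -> : (\sum_(i < chromatic_number F) #|f @^-1: [set i]| = #|V|)%N.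
  rewrite -[RHS]sum1_card (partition_big f xpredT) //=; apply: eq_bigr => i _.
  by rewrite -sum1_card; apply: eq_bigl => x; rewrite !inE.
by rewrite mulfV.
Qed.

(** Let [c] be the chromatic number. If [c <= k], the colours are shifted so that class 0 is empty.
    If [c = k + 1], the bound on [chi_cr] rearranges to [alpha * (a + k * b) <= a], and a smallest
    class is moved to colour 0. If [c > k + 1], the bound forces [alpha = 0], and dropping the empty
    class contradicts the minimality of [c]. *)
Lemma unbalanced_colouring (R : realType) (k a b : nat) (V : finType) (F : sgraph V) :
  (0 < a)%N -> (a <= b)%N -> J_family (chi_of R k.+1 a b) F ->
  exists f : {ffun V -> 'I_k.+1}, Defs.proper F f /\
    (#|fibre f ord0| * (a + k * b) <= a * #|V|)%N.
Proof.
move=> a0 ab; case: (posnP #|V|) => [V0 _|V0].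
  exists [ffun=> ord0]; split; first by apply/properP => x; have := card0_eq V0 x.
  set S := fibre _ _; have /eqP-> : #|S| == 0%N by rewrite -leqn0 -V0 max_card.
  by rewrite mul0n.
have b0 : (0 < b)%N by exact: leq_trans ab.
have := alpha_chromatic_le1 R F V0; have := alpha_ge0 R F; have := alpha_witness R F.
have := chromatic_colourable F; have := @chromatic_min V F.
rewrite /J_family /chi_cr /chi_of.
move: (alpha R F) (chromatic_number F) => al c cmin /existsP[f0 pf0] alw al0 alc crit.
have abR : a%:R / b%:R <= 1 :> R by rewrite ler_pdivrMr ?ltr0n // mul1r ler_nat.
have bR : 0 < b%:R :> R by rewrite ltr0n.
have kR : (k.+1)%:R - 1 = k%:R :> R by rewrite -natr1 addrK.
rewrite kR in crit.
case: (leqP c k) => [ck|kc].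
  pose f := [ffun x => lift ord0 (widen_ord ck (f0 x))].
  exists f; split.
    apply/properP => x y /(properP _ _ pf0); apply: contra; rewrite !ffunE.
    by move=> /eqP/lift_inj/(congr1 val) /= E; apply/eqP/val_inj.
  rewrite (_ : fibre f ord0 = set0) ?cards0 //; apply/setP => x.
  by rewrite !inE ffunE eq_sym (negPf (neq_lift _ _)).
have cE : c = c.-1.+1 by case: (c) kc.
have c1R : c%:R - 1 = c.-1%:R :> R by rewrite {1}cE -natr1 addrK.
rewrite c1R in crit.
(* Hence with two or more colours [al] is attained by a class rather than being the default 1, and
   [1 - al] is a positive denominator. *)
have al1 : (1 < c)%N -> al < 1.
  move=> c1; rewrite ltNge; apply/negP => al1.
  have : c%:R <= 1 :> R.
    by apply: le_trans alc; rewrite -[leLHS]mul1r; apply: ler_wpM2r.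
  by rewrite leNgt ltr1n c1.
have attained : (1 < c)%N -> exists (f : {ffun V -> 'I_c}) i,
    Defs.proper F f /\ #|f @^-1: [set i]|%:R = al * #|V|%:R.
  move=> c1; have := al1 c1; case: alw => [->|]; first by rewrite ltxx.
  by move=> [f [i [pf ->]]] _; exists f, i; rewrite divfK // pnatr_eq0 -lt0n.
move: kc; rewrite leq_eqVlt => /predU1P[ck|kc].
  (* For [k = 0] the quotient in [chi_cr] is [0 / 0], but the claim is only that one class has at
     most [#|V|] vertices. *)
  have [k0|k0] := posnP k.
    move: f0 pf0; rewrite -ck => f0 pf0; exists f0; split=> //.
    have : (#|fibre f0 ord0| <= #|V|)%N by exact: max_card.
    move: (#|fibre f0 ord0|) => m mV.
    by rewrite k0 mul0n addn0 mulnC leq_mul2l mV orbT.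
  have [|f [i [pf fi]]] := attained; first by rewrite -ck.
  have {}al1 := al1 _; rewrite -ck ltnS in al1; have {al1} := al1 k0 => al1.
  move: f i pf fi; rewrite -ck => f i pf fi.
  pose f' := [ffun x => tperm i ord0 (f x)].
  exists f'; split.
    apply/properP => x y /(properP _ _ pf); apply: contra; rewrite !ffunE.
    by rewrite (inj_eq perm_inj).
  have -> : fibre f' ord0 = f @^-1: [set i].
    apply/setP => x; rewrite !inE ffunE.
    by rewrite -[X in _ == X](tpermL i ord0) (inj_eq perm_inj).
  rewrite -(ler_nat R) !natrM natrD natrM fi.
  rewrite -mulrA mulrCA [leRHS]mulrC; apply: ler_wpM2l => //.
  move: crit; rewrite -ck /= lerD2l ler_pdivrMr ?subr_gt0 //.
  rewrite mulrAC ler_pdivlMr //; lra.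
have c1 : (1 < c)%N by apply: leq_ltn_trans kc.
have kc1 : k.+1%:R <= c.-1%:R :> R by rewrite ler_nat -ltnS -cE.
(* Here [chi <= k + 1 <= c - 1], so the second term of [chi_cr] is at most zero. *)
have al_0 : al = 0.
  apply/eqP; rewrite eq_le al0 andbT.
  have : al * c.-1%:R / (1 - al) <= 0.
    by move: kc1 crit abR; rewrite -natr1; move: (_ / (1 - al)) (_ / b%:R) => x y; lra.
  rewrite ler_pdivrMr ?subr_gt0 ?al1 // mul0r.
  by rewrite pmulr_lle0 // ltr0n -ltnS -cE.
have [f [i [pf]]] := attained c1.
rewrite al_0 mul0r => /eqP; rewrite pnatr_eq0 cards_eq0 => /eqP fi.
have avoid x : i != f x.
  by apply/eqP => E; move/setP/(_ x): fi; rewrite !inE E eqxx.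
have : colourable F c.-1.
  apply/existsP; exists [ffun x => sval (unlift_some (avoid x))].
  apply/properP => x y /(properP _ _ pf); apply: contra; rewrite !ffunE.
  case: (unlift_some (avoid x)) => jx /= Ex _; case: (unlift_some (avoid y)) => jy /= Ey _.
  by rewrite Ex Ey => /eqP ->.
by move/cmin; rewrite leqNgt {2}cE leqnn.
Qed.

(** * From fractional tilings to cluster tuples *)

Lemma B_chi_partE (k a b : nat) (i : 'I_k.+1) :
  B_chi_part a b i = if i == ord0 then a else b.
Proof. by []. Qed.

Lemma card_B_chi (k a b : nat) :
  #|multipartite_vertex (B_chi_part (k := k.+1) a b)| = (a + k * b)%N.
Proof.
rewrite card_tagged sumnE big_map big_enum /= big_ord_recl card_ord; congr (_ + _)%N.
rewrite (eq_bigr (fun=> b)) => [|i _]; last by rewrite card_ord.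
by rewrite sum_nat_const card_ord.
Qed.

(* A homomorphic copy of [B_chi] is split into tuples by choosing one vertex
   uniformly in each part. *)
Lemma tiling_tuples (R : realType) (k a b : nat) (W L : finType) (G : sgraph W)
    (P : W -> L)
    (om : {ffun multipartite_vertex (B_chi_part (k := k.+1) a b) -> W} -> R) :
  (0 < a)%N -> (0 < b)%N -> fractional_tiling (B_chi k.+1 a b) G om ->
  exists w : {ffun 'I_k.+1 -> L} -> R,
    [/\ (forall q, 0 <= w q),
      \sum_q w q = \sum_(th in Defs.Hom (B_chi k.+1 a b) G) om th,
      (forall l, \sum_q w q * (\sum_i (q i == l)%:R *
          (if i == ord0 then a%:R else b%:R)) <= #|fibre P l|%:R),
      (forall q i, 0 < w q -> exists x, P x = q i) &
      (forall q i j, 0 < w q -> i != j ->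
         exists x y, [/\ adj G x y, P x = q i & P y = q j])].
Proof.
move=> a0 b0 [om01 om1]; pose s := B_chi_part (k := k.+1) a b.
pose part i (u : 'I_(s i)) : multipartite_vertex s := Tagged (fun i => 'I_(s i)) u.
pose occ (th : {ffun multipartite_vertex s -> W}) i l :=
  #|[set u : 'I_(s i) | P (th (part i u)) == l]|.
(* The probability that a uniform vertex of part [i] is mapped into [l]; the parts choose
   independently, whence the product in [w]. *)
pose fr th i l : R := (occ th i l)%:R / (s i)%:R.
have s0 i : (s i)%:R != 0 :> R.
  by rewrite pnatr_eq0 -lt0n /s B_chi_partE; case: ifP.
have fr0 th i l : 0 <= fr th i l by rewrite divr_ge0.
have fr1 th i : \sum_l fr th i l = 1.
  suff -> : \sum_l fr th i l = (\sum_l occ th i l)%:R / (s i)%:R.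
    suff -> : (\sum_l occ th i l = s i)%N by rewrite mulfV.
    rewrite -[RHS]card_ord -sum1_card.
    rewrite [RHS](partition_big (fun u => P (th (part i u))) xpredT) //=.
    by apply: eq_bigr => l _; rewrite /occ -sum1_card; apply: eq_bigl => u; rewrite inE.
  by rewrite natr_sum mulr_suml.
pose w (q : {ffun 'I_k.+1 -> L}) :=
  \sum_(th in Defs.Hom (B_chi k.+1 a b) G) om th * \prod_i fr th i (q i).
have prod1 th : \sum_(q : {ffun 'I_k.+1 -> L}) \prod_i fr th i (q i) = 1.
  by rewrite -bigA_distr_bigA big1.
have marg th i l : \sum_(q : {ffun 'I_k.+1 -> L})
    (\prod_j fr th j (q j)) * (q i == l)%:R = fr th i l.
  (* The indicator is absorbed into factor [i]; distributing the product over the sum leaves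
     [fr th i l] and factors equal to 1. *)
  pose F j m := fr th j m * (if j == i then (m == l)%:R else 1).
  rewrite (eq_bigr (fun q : {ffun 'I_k.+1 -> L} => \prod_j F j (q j))); last first.
    move=> q _; rewrite /F [RHS]big_split /=.
    rewrite [X in _ = _ * X](_ : _ = (q i == l)%:R) //.
    by rewrite (bigD1 i) //= eqxx big1 ?mulr1 // => j /negPf ->.
  rewrite -bigA_distr_bigA (bigD1 i) //= [X in _ * X]big1 ?mulr1; last first.
    move=> j /negPf ji; rewrite -[RHS](fr1 th j); apply: eq_bigr => m _.
    by rewrite /F ji mulr1.
  rewrite /F (bigD1 l) //= !eqxx mulr1 big1 ?addr0 // => m /negPf ->.
  by rewrite mulr0.
have om0 th : th \in Defs.Hom (B_chi k.+1 a b) G -> 0 <= om th.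
  by move/om01 => /andP[].
have support q : 0 < w q -> exists2 th, th \in Defs.Hom (B_chi k.+1 a b) G &
    forall i, exists u, P (th (part i u)) = q i.
  move=> wq; case: (boolP [exists th in Defs.Hom (B_chi k.+1 a b) G,
      \prod_i fr th i (q i) != 0]).
    case/exists_inP => th thH /prodf_neq0 nz; exists th => // i.
    have : fr th i (q i) != 0 by exact: nz.
    rewrite /fr mulf_eq0 negb_or pnatr_eq0 -lt0n => /andP[/card_gt0P[u]].
    by rewrite inE => /eqP ? _; exists u.
  move=> /exists_inPn none; move: wq; rewrite /w big1 ?ltxx // => th thH.
  by move: (none th thH); rewrite negbK => /eqP ->; rewrite mulr0.
exists w; split.
- move=> q; apply: sumr_ge0 => th thH; rewrite mulr_ge0 ?om0 // prodr_ge0 //.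
- rewrite exchange_big /=; apply: eq_bigr => th _.
  by rewrite -mulr_sumr prod1 mulr1.
- move=> l.
  have -> : \sum_q w q * (\sum_i (q i == l)%:R * (if i == ord0 then a%:R else b%:R)) =
     \sum_(th in Defs.Hom (B_chi k.+1 a b) G) om th * \sum_i (occ th i l)%:R.
    transitivity (\sum_(q : {ffun 'I_k.+1 -> L}) \sum_(th in Defs.Hom (B_chi k.+1 a b) G) om th *
        \sum_i (\prod_j fr th j (q j) * (q i == l)%:R) * (s i)%:R).
      apply: eq_bigr => q _; rewrite mulr_suml; apply: eq_bigr => th _.
      rewrite -mulrA mulr_sumr; congr (_ * _); apply: eq_bigr => i _.
      by rewrite mulrA /s B_chi_partE; case: ifP.
    rewrite exchange_big /=; apply: eq_bigr => th _; rewrite -mulr_sumr.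
    congr (_ * _); rewrite exchange_big /=; apply: eq_bigr => i _.
    by rewrite -mulr_suml marg divfK.
  (* Over all parts, the occurrences count the vertices of [B_chi] mapped into [l]; grouped by image
     they match the tiling constraints. *)
  have occE th : \sum_i (occ th i l)%:R = \sum_(v in fibre P l) #|th @^-1: [set v]|%:R :> R.
    rewrite -!natr_sum; congr _%:R.
    transitivity #|[set z | P (th z) == l]|.
      transitivity (\sum_i \sum_(u : 'I_(s i) | P (th (part i u)) == l) 1)%N.
        apply: eq_bigr => i _; rewrite /occ -sum1_card; apply: eq_bigl => u.
        by rewrite inE.
      rewrite (sig_big_dep _ _ (fun _ _ => 1%N)) -sum1_card; apply: eq_bigl => -[i u].
      by rewrite inE.
    rewrite -sum1_card (partition_big th (mem (fibre P l))) /=; last by move=> z; rewrite !inE.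
    apply: eq_bigr => v vl; rewrite -sum1_card; apply: eq_bigl => z.
    have Pv : P v == l by move: vl; rewrite !inE.
    rewrite !inE andbC; case: (th z =P v) => //= ->; exact: Pv.
  under eq_bigr do rewrite occE mulr_sumr.
  rewrite exchange_big /= -[leRHS]mulr1 -sumr_const mulr_suml.
  by apply: ler_sum => v _; rewrite mul1r; exact: om1.
- move=> q i /support[th _ /(_ i)[u Pu]]; by exists (th (part i u)).
- move=> q i j /support[th thH thq] ij.
  have [u Pu] := thq i; have [u' Pu'] := thq j.
  exists (th (part i u)), (th (part j u')); split=> //.
  move: thH; rewrite inE => /forallP/(_ (part i u))/forallP/(_ (part j u'))/implyP; apply.
  exact: ij.
Qed.

(** * Cleaning up a regularity partition *)

Lemma edge_count_sym (V : finType) (G : sgraph V) (X Y : {set V}) :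
  edge_count G X Y = edge_count G Y X.
Proof.
have countE A B : edge_count G A B = (\sum_(x in A) \sum_(y in B) adj G x y)%N.
  apply: eq_bigr => x _; rewrite -sum1_card [RHS]big_mkcond [LHS]big_mkcond /=.
  by apply: eq_bigr => y _; rewrite inE; case: (y \in B); case: adj.
rewrite !countE exchange_big; apply: eq_bigr => y _; apply: eq_bigr => x _.
by rewrite adj_sym.
Qed.

Lemma lower_regular_sym (R : realType) (V : finType) (G : sgraph V) (eps d : R)
    (A B : {set V}) :
  lower_regular G eps d A B = lower_regular G eps d B A.
Proof.
suff half A' B' : lower_regular G eps d A' B' -> lower_regular G eps d B' A'.
  by apply/idP/idP; exact: half.
move=> reg; apply/forallP => X; apply/forallP => Y; apply/implyP.
case/and4P => XB YA Xl Yl; move/forallP/(_ Y)/forallP/(_ X)/implyP: reg.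
by rewrite XB YA Xl Yl edge_count_sym mulrAC; apply.
Qed.

(** Vertices on more than [mu / 2 * n] irregular edges are deleted, at most [2 * beta / mu * n] by
    double counting, and so are those in clusters smaller than [c * n], at most [c * M * n]. Only
    regular edges are kept. A surviving vertex loses at most [mu / 2 * n] irregular edges and
    [tau * n <= mu / 2 * n] deleted neighbours. *)
Lemma regular_approximation (R : realType) (mu tau eps d c beta : R)
    (V : finType) (G : sgraph V) (M : nat) (P : V -> 'I_M) :
  0 < mu -> 0 <= c -> 2 * beta / mu + c * M%:R <= tau -> tau <= mu / 2 ->
  #|irregular_edges G eps d P|%:R <= beta * #|V|%:R ^+ 2 ->
  exists (W : {set V}) (G' : sgraph {x : V | x \in W}),
    [/\ approximation mu mu G G', (1 - tau) * #|V|%:R <= #|W|%:R,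
      (forall v, v \in W -> c * #|V|%:R <= #|fibre P (P v)|%:R) &
      (forall x y, adj G' x y ->
        adj G (val x) (val y) /\
        lower_regular G eps d (fibre P (P (val x))) (fibre P (P (val y))))].
Proof.
move=> mu0 c0 tauge taule irr; set n : R := #|V|%:R in irr *.
pose irrdeg v := #|[set y | (v, y) \in irregular_edges G eps d P]|.
pose bad1 := [set v | mu / 2 * n < (irrdeg v)%:R].
pose bad2 := [set v | #|fibre P (P v)|%:R < c * n].
pose W := ~: (bad1 :|: bad2).
have n0 : 0 <= n by exact: ler0n.
have irrsum : \sum_v (irrdeg v)%:R = #|irregular_edges G eps d P|%:R :> R.
  rewrite -natr_sum -sum1_card; congr _%:R.
  transitivity (\sum_v \sum_(y | (v, y) \in irregular_edges G eps d P) 1)%N.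
    by apply: eq_bigr => v _; rewrite /irrdeg -sum1_card; apply: eq_bigl => y; rewrite inE.
  by rewrite pair_big_dep; apply: eq_bigl => -[].
have bad1S : #|bad1|%:R * mu <= 2 * beta * n.
  have : #|bad1|%:R * (mu / 2 * n) <= beta * n ^+ 2.
    apply: le_trans irr; rewrite -irrsum mulr_natl -sumr_const.
    rewrite [leRHS](bigID (mem bad1)) /= -[leLHS]addr0; apply: lerD.
      by apply: ler_sum => v; rewrite inE => /ltW.
    exact: sumr_ge0.
  have [n_0|n_pos] := posnP #|V|.
    have -> : #|bad1|%:R = 0 :> R.
      by apply/eqP; rewrite pnatr_eq0 -leqn0 -n_0 max_card.
    by move=> _; rewrite mul0r /n n_0 mulr0.
  have npos : 0 < n by rewrite ltr0n.
  move=> h; rewrite -(ler_pM2r npos).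
  have -> : 2 * beta * n * n = 2 * (beta * n ^+ 2) by ring.
  have -> : #|bad1|%:R * mu * n = 2 * (#|bad1|%:R * (mu / 2 * n)) by field.
  exact: ler_wpM2l.
have bad2S : #|bad2|%:R <= c * M%:R * n.
  have -> : c * M%:R * n = \sum_(i < M) c * n.
    by rewrite sumr_const card_ord -[RHS]mulr_natr mulrAC.
  rewrite -sum1_card (partition_big P xpredT) //= natr_sum; apply: ler_sum => i _.
  have [v /andP[vbad /eqP <-]|none] := pickP [pred v in bad2 | P v == i]; last first.
    by rewrite big_pred0 => [|v]; [exact: mulr_ge0 | exact: none].
  move: vbad; rewrite inE => /ltW; apply: le_trans.
  rewrite sum1_card ler_nat; apply: subset_leq_card; apply/subsetP => u.
  by rewrite unfold_in !inE => /andP[].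
have WS : #|~: W|%:R <= tau * n.
  rewrite setCK; apply: le_trans (_ : #|bad1|%:R + #|bad2|%:R <= _).
    by rewrite -natrD ler_nat leq_card_setU.
  apply: le_trans (_ : (2 * beta / mu + c * M%:R) * n <= _); last exact: ler_wpM2r.
  by rewrite mulrDl lerD // mulrAC ler_pdivlMr.
have WE : #|W|%:R = n - #|~: W|%:R.
  by rewrite /n -(cardsC W) natrD addrK.
pose r x y := adj G x y && lower_regular G eps d (fibre P (P x)) (fibre P (P y)).
pose r' := [rel x y : {x : V | x \in W} | r (val x) (val y)].
have r_sym : symmetric r'.
  by move=> x y; rewrite /r' /= /r adj_sym lower_regular_sym.
have r_irr : irreflexive r' by move=> x; rewrite /r' /= /r adj_irr.
exists W, (SGraph r_sym r_irr); split.
- split.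
  + by move=> x y /andP[].
  + move=> v; rewrite lerBlDr.
    have vW : val v \in W by exact: valP.
    apply: le_trans (_ : (degree (SGraph r_sym r_irr) v)%:R
                + ((irrdeg (val v))%:R + #|~: W|%:R) <= _).
      rewrite -!natrD ler_nat /degree.
      (* A neighbour in [G] survives in [G'], is joined by an irregular edge, or was deleted. *)
      apply: leq_trans (_ : #|(val @: [set u | adj (SGraph r_sym r_irr) v u]) :|:
          ([set y | (val v, y) \in irregular_edges G eps d P] :|: ~: W)| <= _)%N.
        apply: subset_leq_card; apply/subsetP => u; rewrite inE => vu.
        rewrite !in_setU; apply/orP; case: (boolP (u \in W)) => uW; last first.
          by right; rewrite [u \in ~: W]inE uW orbT.
        case: (boolP (lower_regular G eps d (fibre P (P (val v))) (fibre P (P u)))) => reg.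
          left; apply/imsetP; exists (exist _ u uW) => //.
          by rewrite inE /= /r vu.
        by right; rewrite !inE /= vu reg.
      apply: leq_trans (leq_card_setU _ _) _; apply: leq_add; first exact: leq_imset_card.
      exact: leq_card_setU.
    rewrite lerD2l; apply: le_trans (_ : mu / 2 * n + tau * n <= _).
      apply: lerD => //; rewrite leNgt; apply/negP => vb; move: vW.
      by rewrite !inE vb.
    rewrite -mulrDl; apply: ler_wpM2r => //; lra.
  + rewrite WE; apply: le_trans (_ : (1 - tau) * n <= _).
      apply: ler_wpM2r => //; lra.
    by rewrite mulrBl mul1r lerD2l lerN2.
- by rewrite WE mulrBl mul1r lerD2l lerN2.
- by move=> v; rewrite !inE negb_or => /andP[_]; rewrite -leNgt.
- by move=> x y /andP[].
Qed.

(** * Embedding along a fractional tiling of the cleaned graph *)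

Lemma card_sig_set (V : finType) (W : {set V}) : #|{: {x : V | x \in W}}| = #|W|.
Proof. by rewrite card_sig; apply: eq_card => x; rewrite inE. Qed.

Lemma fibre_sig_le (V L : finType) (W : {set V}) (P : V -> L) (l : L) :
  (#|fibre (fun x : {x : V | x \in W} => P (val x)) l| <= #|fibre P l|)%N.
Proof.
rewrite -(card_imset _ val_inj); apply: subset_leq_card; apply/subsetP => y.
by case/imsetP => x; rewrite !inE => + ->.
Qed.

(* The components of [H] are so small that each can be embedded greedily into
   the still unused part of a tuple of pairwise regular clusters. *)
Lemma contained_in_of_tiling (R : realType) (k a b Delta M : nat)
    (rho rho' tau c eps d xi : R) (V : finType) (G : sgraph V) (P : V -> 'I_M)
    (W : {set V}) (G' : sgraph {x : V | x \in W}) (U : finType) (H : sgraph U) :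
  (0 < a)%N -> (a <= b)%N -> 0 < rho' <= 1 -> rho <= rho' / 4 -> tau <= rho' / 4 ->
  0 <= eps -> 0 < d <= 1 -> 0 < c -> 0 < xi ->
  Delta.+1%:R * eps <= d ^+ Delta * (rho' / 4) / 2 ->
  xi <= (rho' / 4 * c) ^+ 2 -> xi <= c * (d ^+ Delta * (rho' / 4) / 2) ->
  (0 < #|V|)%N ->
  (1 - tau) * #|V|%:R <= #|W|%:R ->
  (forall v, v \in W -> c * #|V|%:R <= #|fibre P (P v)|%:R) ->
  (forall x y, adj G' x y ->
     lower_regular G eps d (fibre P (P (val x))) (fibre P (P (val y)))) ->
  has_perfect_fractional_tiling (B_chi k.+1 a b) G' rho ->
  B_family ((1 - rho') * #|V|%:R) (xi * #|V|%:R) Delta H ->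
  J_family (chi_of R k.+1 a b) H ->
  contained_in H G.
Proof.
move=> a0 ab /andP[r0 r1] rhole taule eps0 d01 c0 xi0 epsle xile1 xile2 V0 WV Wbig G'reg.
move=> [om [omT omW]] [UV degH compH] JH.
have b0 : (0 < b)%N by exact: leq_trans ab.
set n : R := #|V|%:R in WV Wbig UV compH.
have n0 : 0 < n by rewrite ltr0n.
have [v0 _] := card_gt0P V0.
have [f [/properP fprop f0]] := unbalanced_colouring a0 ab JH.
pose P' (x : {x : V | x \in W}) := P (val x).
have [w [w0 wsum wload wocc wadj]] := tiling_tuples P' a0 b0 omT.
pose T := \sum_q w q.
pose S : R := a%:R + k%:R * b%:R.
have S0 : 0 < S by rewrite ltr_wpDr ?ltr0n // mulr_ge0.
have eta0 : 0 < rho' / 4 by rewrite divr_gt0.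
(* [S * T] is the weight of the tiling, at least [(1 - rho) * (1 - tau) * n], and
   [(1 - rho' / 4) ^ 2 >= 1 - rho' / 2]. *)
have ST : (1 - rho' / 2) * n <= S * T.
  move: omW; rewrite /tiling_weight card_B_chi natrD natrM -/S -wsum -/T card_sig_set.
  apply: le_trans; apply: le_trans (_ : (1 - rho) * ((1 - tau) * n) <= _); last first.
    apply: ler_wpM2l => //; lra.
  rewrite mulrA; apply: ler_wpM2r; first exact: ltW.
  apply: le_trans (_ : (1 - rho' / 4) * (1 - rho' / 4) <= _).
    have := sqr_ge0 (rho' / 4); rewrite expr2; lra.
  apply: ler_pM; lra.
have half0 : 0 < 1 - rho' / 2 by lra.
have ST0 : 0 < S * T by apply: lt_le_trans ST; rewrite mulr_gt0.
have T0 : 0 < T by rewrite pmulr_rgt0 in ST0.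
(* With [w] normalised by [T], the mean load of [l] is at most [#|U| * cap l]. *)
pose cap l : R := #|fibre P l|%:R / (S * T).
have cap0 l : 0 <= cap l by rewrite divr_ge0 // ltW.
have [ell [ellq ellload]] : exists ell : U -> 'I_M,
    (forall u, exists q (s : {perm 'I_k.+1}), 0 < w q / T /\
       forall u', connect (adj H) u u' -> ell u' = q (s (f u'))) /\
    (forall l e, 0 <= e -> xi * n * #|U|%:R <= e ^+ 2 ->
       #|fibre ell l|%:R <= #|U|%:R * cap l + e).
  apply: (@allocation R k U _ H f (fun q => w q / T) a%:R b%:R).
  - by rewrite ltr0n.
  - by rewrite ler_nat.
  - by move=> q; rewrite divr_ge0 // ltW.
  - by rewrite -mulr_suml mulfV // lt0r_neq0.
  - by rewrite -natrM -natrD -!natrM ler_nat.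
  - move=> l.
    have -> : \sum_q w q / T * (\sum_i (q i == l)%:R * (if i == ord0 then a%:R else b%:R))
      = (\sum_q w q * (\sum_i (q i == l)%:R * (if i == ord0 then a%:R else b%:R))) / T.
      by rewrite mulr_suml; apply: eq_bigr => q _; rewrite mulrAC.
    have -> : S * cap l = #|fibre P l|%:R / T.
      by rewrite /cap; field; rewrite !lt0r_neq0.
    rewrite ler_pM2r ?invr_gt0 //; apply: le_trans (wload l) _.
    by rewrite ler_nat; exact: fibre_sig_le.
  - exact: compH.
have wpos q : 0 < w q / T -> 0 < w q by rewrite pmulr_lgt0 // invr_gt0.
have ellbig u : c * n <= #|fibre P (ell u)|%:R.
  have [q [s [/wpos wq ellE]]] := ellq u.
  rewrite (ellE u (connect0 _ _)); have [x <-] := wocc q (s (f u)) wq.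
  exact: Wbig (valP x).
have ellreg u u' : adj H u u' ->
    lower_regular G eps d (fibre P (ell u)) (fibre P (ell u')).
  move=> uu'; have [q [s [/wpos wq ellE]]] := ellq u.
  rewrite (ellE u (connect0 _ _)) (ellE u' (connect1 uu')).
  have ne : s (f u) != s (f u') by rewrite (inj_eq perm_inj) fprop.
  have [x [y [xy <- <-]]] := wadj _ _ _ wq ne.
  exact: G'reg.
have Un : #|U|%:R <= n by apply: le_trans UV _; rewrite ger_pMl //; lra.
(* Hence the mean load of [l] is at most a fraction [1 - rho' / 2] of its cluster, which leaves
   [rho' / 4] for the deviation and [rho' / 4] to stay free. *)
have small : (1 - rho') * n <= (1 - rho' / 2) * (S * T).
  apply: le_trans (_ : (1 - rho' / 2) * ((1 - rho' / 2) * n) <= _).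
    rewrite mulrA; apply: ler_wpM2r; first exact: ltW.
    have := sqr_ge0 (rho' / 2); rewrite expr2; lra.
  by apply: ler_wpM2l => //; exact: ltW.
have load l : #|fibre ell l|%:R <= (1 - rho' / 4) * #|fibre P l|%:R.
  (* Clusters receiving no vertex are treated apart: the lower bound [c * n] is known only for those
     in use. *)
  have [u /eqP ul|none] := pickP (fun u => ell u == l); last first.
    have -> : fibre ell l = set0 by apply/setP => u; rewrite !inE none.
    by rewrite cards0 mulr_ge0 //; lra.
  have big := ellbig u; rewrite ul in big.
  apply: le_trans (ellload l (rho' / 4 * #|fibre P l|%:R) _ _) _.
  - by rewrite mulr_ge0 // ltW.
  - apply: le_trans (_ : xi * n * n <= _).
      by apply: ler_wpM2l => //; rewrite mulr_ge0 // ltW.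
    apply: le_trans (_ : (rho' / 4 * (c * n)) ^+ 2 <= _).
      rewrite mulrA [leRHS]exprMn -mulrA -expr2; apply: ler_wpM2r => //; exact: sqr_ge0.
    have r4 : 0 <= rho' / 4 by exact: ltW.
    have cn : 0 <= c * n by rewrite mulr_ge0 // ltW.
    by apply: lerXn2r; rewrite ?nnegrE; [exact: mulr_ge0 | exact: mulr_ge0 | exact: ler_wpM2l].
  have -> : (1 - rho' / 4) * #|fibre P l|%:R =
    (1 - rho' / 2) * #|fibre P l|%:R + rho' / 4 * #|fibre P l|%:R by field.
  rewrite lerD2r /cap mulrCA [leRHS]mulrC; apply: ler_wpM2l => //.
  rewrite ler_pdivrMr //; exact: le_trans small.
have d0 : 0 <= d ^+ Delta * (rho' / 4) / 2.
  by case/andP: d01 => d0 _; rewrite divr_ge0 // mulr_ge0 ?exprn_ge0 // ltW.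
have epsle' : eps + Delta%:R * eps <= d ^+ Delta * (rho' / 4) / 2.
  by move: epsle; rewrite -natr1 mulrDl mul1r addrC.
have Deps : 0 <= Delta%:R * eps by rewrite mulr_ge0.
apply: (@component_embedding R U V _ H G P ell Delta eps d (rho' / 4) (xi * n) v0) => //.
- exact: ltW.
- lra.
- move=> u; set p : R := #|_|%:R.
  (* One half pays for the component of size at most [xi * n], the other for the low-degree sets. *)
  have -> : d ^+ Delta * (rho' / 4) * p = d ^+ Delta * (rho' / 4) / 2 * p
     + d ^+ Delta * (rho' / 4) / 2 * p by field.
  apply: lerD; last by rewrite mulrA; apply: ler_wpM2r => //; lra.
  apply: le_trans (_ : c * (d ^+ Delta * (rho' / 4) / 2) * n <= _).
    by apply: ler_wpM2r => //; exact: ltW.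
  by rewrite mulrAC [leRHS]mulrC; apply: ler_wpM2r => //; exact: ellbig.
Qed.

(** * Choice of the constants *)

Unset Implicit Arguments.

Theorem theorem10p1 (R : realType) (k a b Delta : nat) (mu rho' : R)
  (k_gt0 : (0 < k)%N) (a_gt0 : (0 < a)%N) (b_gt0 : (0 < b)%N)
  (Delta_gt0 : (0 < Delta)%N) (le_ab : (a <= b)%N) (co_ab : coprime a b)
  (mu_bnd : 0 < mu <= 1) (rho'_bnd : 0 < rho' <= 1) :
  exists2 rho0 : R, 0 < rho0 & forall rho : R, 0 < rho <= rho0 ->
  exists2 xi0 : R, 0 < xi0 & forall xi : R, 0 < xi <= xi0 ->
  exists n0 : nat, forall n : nat, (n0 <= n)%N -> forall l t : nat,
  forall (V : finType) (G : sgraph V), #|V| = n ->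
    robust_tiling_framework mu k a b rho t l G ->
  forall (U : finType) (H : sgraph U),
    B_family ((1 - rho') * n%:R) (xi * n%:R) Delta H ->
    J_family (chi_of R k a b) H ->
    contained_in H G.
Proof.
case: k k_gt0 => // k _; have /andP[mu0 mu1] := mu_bnd; have /andP[r0 r1] := rho'_bnd.
exists (rho' / 4) => [|rho /andP[rho0 rhole]]; first exact: divr_gt0.
(* [tau] is small against both [mu] and [rho']. As [2 * d = gam], the irregular edges cost
   [2 * (2 * d + gam) / mu = tau / 4] and the small clusters at most [gam / 2], which fit into
   [tau]. *)
pose tau := mu * rho' / 8; pose gam := mu * tau / 16; pose d := gam / 2.
have tau0 : 0 < tau by rewrite divr_gt0 // mulr_gt0.
have taumu : tau <= mu / 8.
  by rewrite ler_pM2r ?invr_gt0 // ler_piMr // ltW.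
have taurho : tau <= rho' / 8.
  by rewrite ler_pM2r ?invr_gt0 // ler_piMl // ltW.
have gam0 : 0 < gam by rewrite divr_gt0 // mulr_gt0.
have gamtau : gam <= tau / 16.
  by rewrite ler_pM2r ?invr_gt0 // ler_piMl // ltW.
have d0 : 0 < d by rewrite divr_gt0.
have d1 : d <= 1 by rewrite /d; lra.
(* [sig] is half the fraction of a cluster guaranteed to every candidate set; [eps] is chosen so
   that [eps + Delta * eps = sig]. *)
pose sig := d ^+ Delta * (rho' / 4) / 2; pose eps := sig / Delta.+1%:R.
have sig0 : 0 < sig by rewrite divr_gt0 // mulr_gt0 ?exprn_gt0 // divr_gt0.
have eps0 : 0 < eps by rewrite divr_gt0 // ltr0n.
have [M regularity] := lower_regularity eps0 d0 gam0.
(* Fixed only now, since it depends on the number [M] of parts; [M.+1] keeps the denominator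
   positive. *)
pose c := gam / (2 * M.+1%:R).
have c0 : 0 < c by rewrite divr_gt0 // mulr_gt0 ?ltr0n.
have cM : c * M%:R <= gam / 2.
  rewrite /c invfM mulrA -mulrA; apply: ler_piMr; first by rewrite divr_ge0 // ltW.
  by rewrite mulrC ler_pdivrMr ?ltr0n // mul1r ler_nat.
(* The first term controls the deviation of the loads, the second the size of a component. *)
pose xi0 := Num.min ((rho' / 4 * c) ^+ 2) (c * sig).
exists xi0 => [|xi /andP[xipos]].
  by rewrite lt_min mulr_gt0 ?exprn_gt0 // mulr_gt0 // divr_gt0.
rewrite le_min => /andP[xile1 xile2].
(* All size conditions are proportional to [n], so it remains to have [V] nonempty. *)
exists 1%N => n n1 l t V G Vn robust U H; rewrite -Vn in n1 *.
have [P irr] := regularity V G.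
have [|||||W [G' [apx WV Wbig G'reg]]] :=
    @regular_approximation R mu tau eps d c (2 * d + gam) V G M P.
- exact: mu0.
- exact: ltW.
- have -> : 2 * (2 * d + gam) / mu = tau / 4.
    by rewrite /d /gam; field; exact: lt0r_neq0.
  lra.
- lra.
- exact: irr.
have [tiling _ _] := robust W G' apx.
have dD : 0 < d <= 1 by rewrite d0.
apply: (@contained_in_of_tiling R k a b Delta M rho rho' tau c eps d xi V G P W G') => //.
- lra.
- exact: ltW.
- by rewrite /eps mulrCA mulfV ?mulr1 // pnatr_eq0.
- by move=> x y /G'reg[].
Qed.
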